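(* Consider the ON/OFF channel model with $N$ links under the Longest Connected Queue (LCQ, max-weight) policy. Suppose $\boldsymbol{\lambda}\in\rho\Lambda$ for some $0<\rho<1$. Let $K$ be the smallest positive integer that satisfies $$1-(1-p_{min})^K\ge(1+\rho)/2.$$ Suppose that $K\le N$, let $\hat N=\lceil N/K\rceil K$ and $z=(1-1/K)/(1-1/\hat N)$, and suppose that for some $\beta$ with $0\le\beta<1/(2z)$ the following holds: $$\lambda_i\le\frac{\lambda_{tot}}{\hat N}+\frac{\beta(1-\rho)}{K}\quad\text{for all }i\in\{1,\ldots,N\}.$$ Then $$\overline{Q}_{tot}\le\frac{KD}{(1-\rho)(\frac12-z\beta)},\qquad \overline{W}\le\frac{K(D/\lambda_{tot})}{(1-\rho)(\frac12-z\beta)},$$ where $D=\frac12\left[\lambda_{tot}+\mathbb{E}\{A_{tot}(t)^2\}\right]$. Further, in the special case when $N$ is a multiple of $K$ and traffic is uniform and Poisson (each $A_i(t)$ is Poisson with mean $\lambda_i=\lambda_{tot}/N$ for all $i$), we have $\beta=0$ (i.e. the displayed constraint on the $\lambda_i$ holds with $\beta=0$) and $$\overline{Q}_{tot}\le\frac{2K\lambda_{tot}-\lambda_{tot}^2}{1-\rho},\qquad\overline{W}\le\frac{2K-\lambda_{tot}}{1-\rho}.$$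
   Context: ON/OFF channel model: there are $N$ links (queues) and slotted time $t\in\{0,1,2,\ldots\}$. $A_i(t)$ is the (non-negative integer) number of packets arriving to queue $i$ on slot $t$; the processes $A_i(t)$ are mutually independent over $i$, each i.i.d. over slots, with mean $\lambda_i=\mathbb{E}\{A_i(t)\}>0$ and $\mathbb{E}\{A_i(t)^2\}<\infty$. $S_i(t)\in\{0,1\}$ is the channel state of link $i$; the processes $S_i(t)$ are mutually independent over $i$, i.i.d. over slots, with $\Pr[S_i(t)=1]=p_i$, and independent of the arrivals. Each slot at most one link is selected; $\mu_i(t)=S_i(t)$ if link $i$ is selected on slot $t$ and $\mu_i(t)=0$ otherwise. Queue backlogs evolve as $Q_i(t+1)=\max[Q_i(t)-\mu_i(t),0]+A_i(t)$. The initial backlogs $Q_i(0)$ are non-negative integers with finite second moment, independent of the arrival and channel processes. LCQ (max-weight) policy: each slot $t$, observe all $Q_i(t)$ and $S_i(t)$ and select a link with the largest product $Q_i(t)S_i(t)$, using a stationary probabilistic tie-breaking rule. Notation: $\boldsymbol{\lambda}=(\lambda_1,\ldots,\lambda_N)$, $\lambda_{tot}=\sum_{i=1}^N\lambda_i$, $A_{tot}(t)=\sum_{i=1}^N A_i(t)$, $p_{min}=\min_i p_i$ with $0<p_{min}<1$. Capacity region $\Lambda$: the closure of the set of arrival rate vectors for which some control algorithm strongly stabilizes all queues (i.e. $\limsup_{t\to\infty}\frac1t\sum_{\tau=0}^{t-1}\mathbb{E}\{Q_i(\tau)\}<\infty$ for all $i$); it is known to equal the set of non-negative vectors $\boldsymbol{\lambda}$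 with $\sum_{i\in\mathcal{L}}\lambda_i\le1-\prod_{i\in\mathcal{L}}(1-p_i)$ for every non-empty $\mathcal{L}\subseteq\{1,\ldots,N\}$. $\rho\Lambda=\{\rho x:x\in\Lambda\}$. $\overline{Q}_{tot}=\lim_{t\to\infty}\frac1t\sum_{\tau=0}^{t-1}\sum_{i=1}^N\mathbb{E}\{Q_i(\tau)\}$ is the time average total backlog (the system is a Markov chain for which this time average is well defined under LCQ for rates interior to $\Lambda$). The average delay is, by Little's Theorem, $\overline{W}=\overline{Q}_{tot}/\lambda_{tot}$. Convention for degenerate cases: when $K=1$, take $z=0$ and $1/(2z)=+\infty$. *)

(* Defs.v *)
(* MathComp-Analysis development, over an arbitrary R : realType. *)
From HB Require Import structures.
From mathcomp Require Import all_boot all_order all_algebra.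
From mathcomp Require Import all_classical all_reals all_analysis.

Set Implicit Arguments.
Unset Strict Implicit.
Unset Printing Implicit Defensive.

Import Order.TTheory GRing.Theory Num.Theory.
Import numFieldNormedType.Exports.

Local Open Scope classical_set_scope.
Local Open Scope ring_scope.

(* Indices of the primitive random elements of the model. [Seed t] is a
   private randomization variable of the controller: a randomized decision is
   a deterministic function of the observations and of the seeds. *)
Inductive primitive (N : nat) :=
  | Init | Arrival of nat & 'I_N | Channel of nat & 'I_N | Seed of nat.
Arguments Init {N}.
Arguments Seed {N}.

HB.instance Definition _ (N : nat) := gen_eqMixin (primitive N).

(* Mutual independence of a family of classes of events. *)
Definition mutually_independent {R : realType} {d : measure_display}
    {T : measurableType d} (P : probability T R) (I : eqType)
    (F : I -> set (set T)) : Prop :=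
  forall (J : seq I) (B : I -> set T), uniq J ->
    (forall j, j \in J -> F j (B j)) ->
    P (\big[setI/setT]_(j <- J) B j) = (\prod_(j <- J) P (B j))%E.

(* Events generated by each primitive. The initial backlogs are taken jointly,
   as a vector, so that they may be dependent on one another; the vector lives
   in a countable discrete space, where every set is an event. *)
Definition primitive_events {N : nat} {d dE : measure_display}
    {T : measurableType d} {E : measurableType dE}
    (Q0 : 'I_N -> T -> nat) (A : nat -> 'I_N -> T -> nat)
    (S : nat -> 'I_N -> T -> bool) (U : nat -> T -> E)
    (x : primitive N) : set (set T) :=
  match x with
  | Init => [set (fun w i => Q0 i w) @^-1` B | B in [set: set ('I_N -> nat)]]
  | Arrival t i => [set A t i @^-1` B | B in measurable]
  | Channel t i => [set S t i @^-1` B | B in measurable]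
  | Seed t => [set U t @^-1` B | B in measurable]
  end.

(* [A t i w] packets arrive to queue [i] on slot [t], [S t i w] is the channel
   state of link [i] on slot [t]. *)
Record on_off_model {R : realType} {d dE : measure_display}
    {T : measurableType d} (P : probability T R) {E : measurableType dE}
    {N : nat} (lambda : 'rV[R]_N) (p : 'I_N -> R)
    (Q0 : 'I_N -> T -> nat) (A : nat -> 'I_N -> T -> nat)
    (S : nat -> 'I_N -> T -> bool) (U : nat -> T -> E) : Prop := OnOffModel {
  measurable_init : forall i, measurable_fun setT (Q0 i);
  measurable_arrival : forall t i, measurable_fun setT (A t i);
  measurable_channel : forall t i, measurable_fun setT (S t i);
  measurable_seed : forall t, measurable_fun setT (U t);
  primitives_independent :
    mutually_independent P (primitive_events Q0 A S U);
  arrival_identically_distributed : forall t i (B : set nat),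
    P (A t i @^-1` B) = P (A 0%N i @^-1` B);
  arrival_mean : forall t i,
    ('E_P[fun w => (A t i w)%:R] = (lambda ord0 i)%:E)%E;
  arrival_second_moment : forall t i,
    ('E_P[fun w => ((A t i w)%:R ^+ 2)%R] < +oo)%E;
  channel_on : forall t i, P [set w | S t i w] = (p i)%:E;
  seed_identically_distributed : forall t (B : set E), measurable B ->
    P (U t @^-1` B) = P (U 0%N @^-1` B);
  init_second_moment : forall i,
    ('E_P[fun w => ((Q0 i w)%:R ^+ 2)%R] < +oo)%E }.

(* [sel t w] is the link selected on slot [t], if any. Subtraction on [nat] is
   truncated, so [_ - mu] is max[_ - mu, 0]. *)
Definition queue_dynamics {T : Type} {N : nat} (Q0 : 'I_N -> T -> nat)
    (A : nat -> 'I_N -> T -> nat) (S : nat -> 'I_N -> T -> bool)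
    (sel : nat -> T -> option 'I_N) (Q : nat -> 'I_N -> T -> nat) : Prop :=
  (forall i w, Q 0%N i w = Q0 i w) /\
  (forall t i w,
     let mu := nat_of_bool (S t i w && (sel t w == Some i)) in
     Q t.+1 i w = (Q t i w - mu + A t i w)%N).

(* A causal, possibly randomized and history-dependent, control algorithm:
   [phi] maps the past and present backlogs, channel states and seeds (slots
   0, ..., t in this order) to the link selected on slot t, if any. *)
Definition controlled_by {T E : Type} {N : nat}
    (phi : seq (('I_N -> nat) * ('I_N -> bool) * E) -> option 'I_N)
    (S : nat -> 'I_N -> T -> bool) (U : nat -> T -> E)
    (Q : nat -> 'I_N -> T -> nat) (sel : nat -> T -> option 'I_N) : Prop :=
  forall t w,
    sel t w = phi [seq (Q s ^~ w, S s ^~ w, U s w) | s <- iota 0 t.+1].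

(* A stationary probabilistic tie-breaking rule: given backlogs [q] and channel
   states [s], the link [tie q s u] maximizes q_i s_i, and is random through
   the fresh i.i.d. seed [u]. *)
Definition lcq_rule {dE : measure_display} {E : measurableType dE} {N : nat}
    (tie : ('I_N -> nat) -> ('I_N -> bool) -> E -> 'I_N) : Prop :=
  (forall q s i, measurable [set u | tie q s u = i]) /\
  (forall q (s : 'I_N -> bool) u i, (q i * s i <= q (tie q s u) * s (tie q s u))%N).

Definition lcq_selection {T E : Type} {N : nat}
    (tie : ('I_N -> nat) -> ('I_N -> bool) -> E -> 'I_N)
    (S : nat -> 'I_N -> T -> bool) (U : nat -> T -> E)
    (Q : nat -> 'I_N -> T -> nat) (t : nat) (w : T) : option 'I_N :=
  Some (tie (Q t ^~ w) (S t ^~ w) (U t w)).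

Section TimeAverages.
Context {R : realType} {d : measure_display} {T : measurableType d}.
Context (P : probability T R) {N : nat} (Q : nat -> 'I_N -> T -> nat).

Definition average_backlog (i : 'I_N) (t : nat) : \bar R :=
  (t%:R^-1%:E * \sum_(0 <= tau < t) 'E_P[fun w => (Q tau i w)%:R])%E.

Definition strongly_stable : Prop :=
  forall i, (limn_esup (average_backlog i) < +oo)%E.

Definition average_total_backlog (t : nat) : \bar R :=
  (t%:R^-1%:E *
   \sum_(0 <= tau < t) \sum_(i < N) 'E_P[fun w => (Q tau i w)%:R])%E.

(* The time average total backlog. It is the limit of [average_total_backlog]
   whenever that limit exists ([Qbar_tot_lim]); using the limit superior, an
   upper bound on it needs no convergence assumption. *)
Definition Qbar_tot : \bar R := limn_esup average_total_backlog.

Lemma Qbar_tot_lim (l : \bar R) :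
  average_total_backlog @ \oo --> l -> Qbar_tot = l.
Proof.
move=> avg_l; rewrite /Qbar_tot limn_esup_lim.
exact/cvg_lim/cvg_esups.
Qed.

End TimeAverages.

(* Rate vectors for which some arrival processes with these rates, over links
   with ON probabilities [p], are strongly stabilized by some control
   algorithm. *)
Definition stabilizable {R : realType} {N : nat} (p : 'I_N -> R) :
    set 'rV[R]_N :=
  [set lambda | exists (d dE : measure_display) (T : measurableType d)
      (P : probability T R) (E : measurableType dE)
      (Q0 : 'I_N -> T -> nat) (A : nat -> 'I_N -> T -> nat)
      (S : nat -> 'I_N -> T -> bool) (U : nat -> T -> E)
      (phi : seq (('I_N -> nat) * ('I_N -> bool) * E) -> option 'I_N)
      (sel : nat -> T -> option 'I_N) (Q : nat -> 'I_N -> T -> nat),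
    [/\ on_off_model P lambda p Q0 A S U,
        controlled_by phi S U Q sel,
        (forall t i, measurable [set w | sel t w = Some i]),
        queue_dynamics Q0 A S sel Q
      & strongly_stable P Q]].

Definition capacity_region {R : realType} {N : nat} (p : 'I_N -> R) :
    set 'rV[R]_N :=
  closure (stabilizable p).

Section SystemConstants.
Context {R : realType} {N : nat}.
Implicit Types (lambda : 'rV[R]_N) (p : 'I_N -> R) (rho beta : R) (K : nat).

(* The default value 1 is harmless, the p_i being probabilities. *)
Definition p_min p : R := \big[Num.min/1]_(i < N) p i.

Definition lambda_tot lambda : R := \sum_(i < N) lambda ord0 i.

Definition is_smallest_K (pmin rho : R) K : Prop :=
  let large k := (1 + rho) / 2 <= 1 - (1 - pmin) ^+ k in
  [/\ (0 < K)%N, large K & forall k, (0 < k)%N -> large k -> (K <= k)%N].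

Definition N_hat K : R := (Num.ceil (N%:R / K%:R : R))%:~R * K%:R.

(* For K = 1 the quotient is 0 (or 0/0 if moreover N = 1), hence z = 0. *)
Definition z_coef K : R :=
  if K == 1%N then 0 else (1 - K%:R^-1) / (1 - (N_hat K)^-1).

(* 1 / (2 z), with the convention 1 / 0 = +oo. *)
Definition half_inv (z : R) : \bar R :=
  if z == 0 then +oo%E else ((2 * z)^-1)%:E.

Definition rate_constraint lambda rho beta K : Prop :=
  forall i, lambda ord0 i <=
    lambda_tot lambda / N_hat K + beta * (1 - rho) / K%:R.

Definition beta_admissible lambda rho beta K : Prop :=
  [/\ 0 <= beta, (beta%:E < half_inv (z_coef K))%E
    & rate_constraint lambda rho beta K].

End SystemConstants.

(* The arrivals being i.i.d. over slots, the second moment of the total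
   arrivals is the same on every slot; slot 0 is used. *)
Definition D_const {R : realType} {d : measure_display} {T : measurableType d}
    (P : probability T R) {N : nat} (lambda : 'rV[R]_N)
    (A : nat -> 'I_N -> T -> nat) : \bar R :=
  (2^-1%:E * ((lambda_tot lambda)%:E +
              'E_P[fun w => ((\sum_(i < N) (A 0%N i w)%:R) ^+ 2)%R]))%E.

(* Average delay, by Little's theorem. *)
Definition Wbar {R : realType} {d : measure_display} {T : measurableType d}
    (P : probability T R) {N : nat} (lambda : 'rV[R]_N)
    (Q : nat -> 'I_N -> T -> nat) : \bar R :=
  (Qbar_tot P Q * (lambda_tot lambda)^-1%:E)%E.

Definition poisson_arrivals {R : realType} {d : measure_display}
    {T : measurableType d} (P : probability T R) {N : nat}
    (lambda : 'rV[R]_N) (A : nat -> 'I_N -> T -> nat) : Prop :=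
  forall t i k, P [set w | A t i w = k] = (poisson_pmf (lambda ord0 i) k)%:E.

(* Main.v *)
Require Import Defs.
From mathcomp Require Import all_boot all_order all_algebra.
From mathcomp Require Import all_classical all_reals all_analysis.
From mathcomp Require Import measurable_realfun ring lra zify.
Import Order.TTheory GRing.Theory Num.Theory.
Import numFieldNormedType.Exports.
Local Open Scope classical_set_scope.
Local Open Scope ring_scope.

Set Implicit Arguments.
Unset Strict Implicit.
Unset Printing Implicit Defensive.

(** The proof is a Lyapunov drift argument. Write q_i, a_i and d_i for the
    backlogs, arrivals and departures of a slot, where d_i is 1 when link i is
    selected, ON and nonempty, and 0 otherwise. Then q_i' = q_i - d_i + a_i,
    and at most one d_i is nonzero. The Lyapunov function is
      V = (1 - z) (sum_i q_i)^2 + z sum_i q_i^2.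
    Let N^ be the least multiple of K that is at least N, and add N^ - N queues
    that stay empty. Then V is the average, over all ways to split the N^ queues
    into K groups of the same size, of the sum of the squares of the group
    backlogs: two given queues share a group with probability 1 - z.
    The coefficients satisfy 1 - z + z / N^ = 1 / K ([z_coef_bounds]).

    Expanding the squares gives the exact one-slot change of E[V]
    ([Ex_lyapunov_step]), since the arrivals of a slot are independent of the
    backlogs and departures of that slot. Two estimates control the terms that
    are linear in the backlogs.

    - Arrivals. The bound on the lambda_i gives
        (1 - z) q_tot lambda_tot + z sum_i q_i lambda_i
          <= (q_tot / K) (lambda_tot + z beta (1 - rho)),
      and lambda_tot <= rho. The last inequality is all that is needed from
      the capacity region: one packet at most leaves per slot, so a total rate
      above 1 cannot be stabilized ([capacity_rate_le1]).

    - Service. Put phi n = 1 - (1 - p_min)^n, and let n_m be the number of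
      queues with more than m packets. As the largest connected queue is
      served, sum_i q_i d_i is at least the number of m such that some queue
      with more than m packets is ON, and sum_i d_i is the indicator that some
      nonempty queue is ON. Given the backlogs, the conditional expectation of
      (1 - z) q_tot sum_i d_i + z sum_i q_i d_i is therefore at least
        (1 - z) q_tot phi n_0 + z sum_m phi n_m,
      which is at least q_tot phi K / K because phi is concave and increasing
      and sum_m n_m = q_tot ([coverage_bound], [service_lower]). Finally
      phi K >= (1 + rho) / 2 by the choice of K.

    Together, E[V] changes by at most a constant minus
    (2 (1 - rho) (1/2 - z beta) / K) E[q_tot] ([Ex_lyapunov_drift]), and
    summing over slots bounds the time average of E[q_tot]
    ([telescoping_drift], [Qbar_tot_le]). The constant contains a multiple of
    the departure rate, whose sum over slots is known up to E[q_tot], which is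
    at most E[V] because the backlogs are integers; so no bound on the growth
    of E[q_tot] is needed. Dropping the terms - 2 lambda_i E[d_i] gives the
    general bound; keeping them, with E[a_i^2] = lambda_i + lambda_i^2, gives
    the Poisson one.

    Independence of the state of slot t from the channels and arrivals of slot
    t has to be derived from mutual independence of the primitives. The event
    that the backlog vector takes a given value on slot t is shown, by
    induction on t, to be independent of all the primitives of slots >= t
    ([indep_backlogs]): it is a countable disjoint union of intersections of an
    event of the previous slot with primitive events. Conditioning is then
    replaced by a Fubini formula for independent random variables with
    countably many values ([freezing]). *)

(** * Random variables with countably many values *)

Section CountableRV.
Context {d : measure_display} {T : measurableType d}.

(** A random variable with values in a countable type, all of whose subsets are
    regarded as events: it suffices that its level sets be measurable. *)
Definition countable_rv {C : countType} (X : T -> C) : Prop :=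
  forall c, measurable (X @^-1` [set c]).

(** The level sets of [X], indexed by the natural numbers that encode the values
    of [X]; empty for a number that is not a code. *)
Definition fiber {C : countType} (X : T -> C) (k : nat) : set T :=
  [set w | pickle (X w) = k].

Lemma preimage_fiber {C : countType} (X : T -> C) (B : set C) :
  X @^-1` B = \bigcup_(k in [set k | exists2 c, B c & pickle c = k]) fiber X k.
Proof.
apply/seteqP; split=> [w Bw|w [k [c Bc <-]] /(pcan_inj pickleK) Xwc].
  by exists (pickle (X w)) => //; exists (X w).
by rewrite /preimage/= Xwc.
Qed.

Lemma fiber_cases {C : countType} (X : T -> C) k :
  fiber X k = set0 \/ exists c, fiber X k = X @^-1` [set c].
Proof.
have [[c ck]|nc] := pselect (exists c : C, pickle c = k); [right|left].
  exists c; apply/seteqP; split=> w; rewrite /fiber /preimage/= -ck.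
    exact/(pcan_inj pickleK).
  by move=> ->.
by rewrite -subset0 => w Xwk; apply: nc; exists (X w).
Qed.

Lemma countable_rv_fiber {C : countType} (X : T -> C) :
  countable_rv X -> forall k, measurable (fiber X k).
Proof.
move=> mX k; have [->|[c ->]] := fiber_cases X k; first exact: measurable0.
exact: mX.
Qed.

Lemma countable_rv_preimage {C : countType} (X : T -> C) (B : set C) :
  countable_rv X -> measurable (X @^-1` B).
Proof.
move=> mX; rewrite preimage_fiber; apply: bigcup_measurable => k _.
exact: countable_rv_fiber.
Qed.

Lemma countable_rv_comp {C C' : countType} (X : T -> C) (g : C -> C') :
  countable_rv X -> countable_rv (g \o X).
Proof. by move=> mX c; rewrite comp_preimage; exact: countable_rv_preimage. Qed.

Lemma countable_rv_pair {C C' : countType} (X : T -> C) (Y : T -> C') :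
  countable_rv X -> countable_rv Y -> countable_rv (fun w => (X w, Y w)).
Proof.
move=> mX mY [c c']; have -> : (fun w => (X w, Y w)) @^-1` [set (c, c')] =
    X @^-1` [set c] `&` Y @^-1` [set c'].
  by apply/seteqP; split=> w; rewrite /preimage/=; [case=> -> ->|case=> -> ->].
exact: measurableI.
Qed.

Lemma measurable_countable_rv {C : countType} d' (T' : measurableType d')
    (X : T -> C) (g : C -> T') :
  countable_rv X -> measurable_fun setT (g \o X).
Proof.
move=> mX _ B mB; rewrite setTI comp_preimage; exact: countable_rv_preimage.
Qed.

Lemma bigcup_fiber {C : countType} (X : T -> C) : \bigcup_k fiber X k = setT.
Proof. by apply/seteqP; split=> // w _; exists (pickle (X w)). Qed.

Lemma trivIset_fiber {C : countType} (X : T -> C) : trivIset setT (fiber X).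
Proof. by move=> i j _ _ [w [<- <-]]. Qed.

End CountableRV.

Section Freezing.
Context {R : realType} {d : measure_display} {T : measurableType d}.
Variable P : probability T R.
Local Open Scope ereal_scope.

Lemma integral_fiber {C : countType} (X : T -> C) (D : set T)
    (g : T -> \bar R) :
  countable_rv X -> measurable D -> measurable_fun D g ->
  (forall w, D w -> 0 <= g w) ->
  \int[P]_(w in D) g w = \sum_(k <oo) \int[P]_(w in D `&` fiber X k) g w.
Proof.
move=> mX mD mg g0; have DE : D = \bigcup_k (D `&` fiber X k).
  by rewrite -setI_bigcupr bigcup_fiber setIT.
rewrite [in LHS]DE ge0_integral_bigcup -?DE//.
- by move=> k; apply: measurableI => //; exact: countable_rv_fiber.
- by apply: trivIset_setIl; exact: trivIset_fiber.
Qed.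

(** Independence of two random variables with countably many values. *)
Definition independent_rv {C C' : countType} (X : T -> C) (Y : T -> C') :
    Prop :=
  forall c c', P (X @^-1` [set c] `&` Y @^-1` [set c']) =
    P (X @^-1` [set c]) * P (Y @^-1` [set c']).

Lemma integral_indep_event {C : countType} (Y : T -> C) (D : set T)
    (h : C -> \bar R) :
  countable_rv Y -> measurable D ->
  (forall c, P (D `&` Y @^-1` [set c]) = P D * P (Y @^-1` [set c])) ->
  (forall c, 0 <= h c) ->
  \int[P]_(w in D) h (Y w) = P D * \int[P]_w h (Y w).
Proof.
move=> mY mD DY h0.
have mh D' : measurable D' -> measurable_fun D' (fun w => h (Y w)).
  move=> mD'; apply: (measurable_funS measurableT (@subsetT _ D')).
  exact: (@measurable_countable_rv _ _ _ _ _ Y h).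
rewrite (@integral_fiber _ Y)//; last exact: mh.
rewrite [in RHS](@integral_fiber _ Y)//; last exact: mh.
rewrite -(fineK (fin_num_measure P D mD)).
rewrite -nneseriesZl; last by move=> k _; exact: integral_ge0.
apply: eq_eseriesr => k _; rewrite setTI (fineK (fin_num_measure P D mD)).
have [->|[c ->]] := fiber_cases Y k.
  by rewrite setI0 !integral_set0 mule0.
have eqc D' : D' `<=` Y @^-1` [set c] ->
    \int[P]_(w in D') h (Y w) = \int[P]_(w in D') h c.
  by move=> D'c; apply: eq_integral => w /[!inE] /D'c ->.
rewrite !eqc//.
rewrite !integral_cst//.
- by rewrite muleCA; congr (_ * _); exact: DY.
- exact: measurableI.
Qed.

(** For independent [X] and [Y], E[f(X, Y)] is computed by integrating over [Y]
    with the value of [X] frozen. *)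
Lemma freezing {C C' : countType} (X : T -> C) (Y : T -> C')
    (f : C -> C' -> \bar R) :
  countable_rv X -> countable_rv Y -> independent_rv X Y ->
  (forall c c', 0 <= f c c') ->
  \int[P]_w f (X w) (Y w) = \int[P]_w \int[P]_w' f (X w) (Y w').
Proof.
move=> mX mY XY f0.
rewrite (@integral_fiber _ X)//; last first.
  apply: (@measurable_countable_rv _ _ _ _ _
    (fun w => (X w, Y w)) (fun c => f c.1 c.2)).
  exact: countable_rv_pair.
rewrite [in RHS](@integral_fiber _ X)//; last 2 first.
- exact: (@measurable_countable_rv _ _ _ _ _ X
    (fun c => \int[P]_w' f c (Y w'))).
- by move=> w _; exact: integral_ge0.
apply: eq_eseriesr => k _; rewrite setTI.
have [->|[c ->]] := fiber_cases X k; first by rewrite !integral_set0.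
transitivity (\int[P]_(w in X @^-1` [set c]) f c (Y w)).
  by apply: eq_integral => w /[!inE] ->.
rewrite integral_indep_event//.
transitivity (\int[P]_(w in X @^-1` [set c]) \int[P]_w' f c (Y w')); last first.
  by apply: eq_integral => w /[!inE] ->.
by rewrite integral_cst// muleC.
Qed.

End Freezing.

(** * Real-valued expectations *)

Section RealExpectation.
Context {R : realType} {d : measure_display} {T : measurableType d}.
Variable P : probability T R.
Implicit Types f g : T -> R.

(** Real random variables with a finite expectation. *)
Definition itg f : Prop := P.-integrable setT (EFin \o f).
(** The expectation as a real number; meaningful when [f] satisfies [itg]. *)
Definition Ex f : R := \int[P]_w f w.

Lemma itg_mfun f : itg f -> measurable_fun setT f.
Proof. by move=> /measurable_int /measurable_EFinP. Qed.

Lemma Ex_EFin f : itg f -> (\int[P]_w (f w)%:E)%E = (Ex f)%:E.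
Proof.
by move=> fi; rewrite /Ex /Rintegral fineK//; exact: integrable_fin_num.
Qed.

Lemma itgD f g : itg f -> itg g -> itg (fun w => f w + g w).
Proof.
move=> fi gi; rewrite /itg.
have -> : EFin \o (fun w => f w + g w) = ((EFin \o f) \+ (EFin \o g))%E by [].
exact: integrableD.
Qed.

Lemma itgZ (c : R) f : itg f -> itg (fun w => c * f w).
Proof.
move=> fi; rewrite /itg; have -> : EFin \o (fun w => c * f w) =
  (fun w => c%:E * (EFin \o f) w)%E by [].
exact: integrableZl.
Qed.

Lemma itgB f g : itg f -> itg g -> itg (fun w => f w - g w).
Proof.
move=> fi gi; rewrite /itg.
have -> : EFin \o (fun w => f w - g w) = ((EFin \o f) \- (EFin \o g))%E by [].
exact: integrableB.
Qed.

Lemma itg_cst (c : R) : itg (fun=> c).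
Proof. exact: finite_measure_integrable_cst. Qed.

Lemma itg_sum (I : Type) (r : seq I) (f : I -> T -> R) :
  (forall i, itg (f i)) -> itg (fun w => \sum_(i <- r) f i w).
Proof.
move=> fi; elim: r => [|i r IH].
  by under [X in itg X]eq_fun => w do rewrite big_nil; exact: itg_cst.
by under [X in itg X]eq_fun => w do rewrite big_cons; exact: itgD.
Qed.

Lemma itg_le f g : measurable_fun setT f -> (forall w, `|f w| <= g w) ->
  itg g -> itg f.
Proof.
move=> mf fg; apply: le_integrable => //; first exact/measurable_EFinP.
by move=> w _ /=; rewrite lee_fin (le_trans (fg w))// ler_norm.
Qed.

Lemma ExD f g : itg f -> itg g -> Ex (fun w => f w + g w) = Ex f + Ex g.
Proof. by move=> fi gi; rewrite /Ex RintegralD. Qed.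

Lemma ExB f g : itg f -> itg g -> Ex (fun w => f w - g w) = Ex f - Ex g.
Proof. by move=> fi gi; rewrite /Ex RintegralB. Qed.

Lemma ExZ (c : R) f : itg f -> Ex (fun w => c * f w) = c * Ex f.
Proof. by move=> fi; rewrite /Ex RintegralZl. Qed.

Lemma Ex_cst (c : R) : Ex (fun=> c) = c.
Proof.
rewrite /Ex Rintegral_cst// [X in fine X](_ : _ = 1%E) ?mulr1//.
exact: probability_setT.
Qed.

Lemma Ex_sum (I : Type) (r : seq I) (f : I -> T -> R) :
  (forall i, itg (f i)) ->
  Ex (fun w => \sum_(i <- r) f i w) = \sum_(i <- r) Ex (f i).
Proof.
move=> fi; elim: r => [|i r IH].
  by under [in LHS]eq_fun => w do rewrite big_nil; rewrite big_nil Ex_cst.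
under [in LHS]eq_fun => w do rewrite big_cons.
by rewrite ExD ?big_cons ?IH//; exact: itg_sum.
Qed.

Lemma Ex_le f g : itg f -> itg g -> (forall w, f w <= g w) -> Ex f <= Ex g.
Proof. by move=> fi gi fg; apply: le_Rintegral. Qed.

Lemma Ex_ge0 f : (forall w, 0 <= f w) -> 0 <= Ex f.
Proof. by move=> f0; apply: Rintegral_ge0. Qed.

(** Real random variables with a finite second moment. *)
Definition sqitg f : Prop := measurable_fun setT f /\ itg (fun w => f w ^+ 2).

Lemma sqitg_mul f g : sqitg f -> sqitg g -> itg (fun w => f w * g w).
Proof.
move=> [mf fi] [mg gi]; apply: (@itg_le _ (fun w => f w ^+ 2 + g w ^+ 2)).
- exact: measurable_funM.
- move=> w; rewrite ler_norml; apply/andP.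
  have := sqr_ge0 (f w + g w); have := sqr_ge0 (f w - g w).
  have := sqr_ge0 (f w); have := sqr_ge0 (g w).
  by rewrite !expr2 => *; split; nra.
- exact: itgD.
Qed.

Lemma sqitg_itg f : sqitg f -> itg f.
Proof.
move=> [mf fi]; apply: (@itg_le _ (fun w => f w ^+ 2 + 1)) => //.
- move=> w; rewrite ler_norml; apply/andP.
  have := sqr_ge0 (f w + 1); have := sqr_ge0 (f w - 1).
  have := sqr_ge0 (f w).
  by rewrite !expr2 => *; split; nra.
- by apply: itgD => //; exact: itg_cst.
Qed.

Lemma sqitgD f g : sqitg f -> sqitg g -> sqitg (fun w => f w + g w).
Proof.
move=> sf sg; have := sqitg_mul sf sg; move: sf sg => [mf fi] [mg gi] fgi.
split; first exact: measurable_funD.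
have -> : (fun w => (f w + g w) ^+ 2) =
    (fun w => f w ^+ 2 + g w ^+ 2 + 2 * (f w * g w)).
  by apply/funext => w; ring.
by apply: itgD; [exact: itgD|exact: itgZ].
Qed.

Lemma sqitg_le f g : measurable_fun setT f -> (forall w, 0 <= f w <= g w) ->
  sqitg g -> sqitg f.
Proof.
move=> mf fg [mg gi]; split=> //; apply: (@itg_le _ (fun w => g w ^+ 2)) => //.
  exact: measurable_funX.
move=> w; have /andP[f0 fgw] := fg w.
by rewrite ger0_norm ?sqr_ge0// lerXn2r ?nnegrE// (le_trans f0).
Qed.

Lemma sqitg_cst (c : R) : sqitg (fun=> c).
Proof. by split=> //; exact: itg_cst. Qed.

Lemma sqitg_sum (I : Type) (r : seq I) (f : I -> T -> R) :
  (forall i, sqitg (f i)) -> sqitg (fun w => \sum_(i <- r) f i w).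
Proof.
move=> fi; elim: r => [|i r IH].
  by under [X in sqitg X]eq_fun => w do rewrite big_nil; exact: sqitg_cst.
by under [X in sqitg X]eq_fun => w do rewrite big_cons; exact: sqitgD.
Qed.

Lemma itg_ge0 f : measurable_fun setT f -> (forall w, 0 <= f w) ->
  (\int[P]_w (f w)%:E < +oo)%E -> itg f.
Proof.
move=> mf f0 foo; apply/integrableP; split; first exact/measurable_EFinP.
by under eq_integral => w _ do rewrite /= ger0_norm//.
Qed.

Lemma Ex_indep_mul {C C' : countType} (X : T -> C) (Y : T -> C')
    (g : C -> R) (h : C' -> R) :
  countable_rv X -> countable_rv Y -> independent_rv P X Y ->
  (forall c, 0 <= g c) -> (forall c, 0 <= h c) ->
  itg (g \o X) -> itg (h \o Y) ->
  Ex (fun w => g (X w) * h (Y w)) = Ex (g \o X) * Ex (h \o Y).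
Proof.
move=> mX mY XY g0 h0 gi hi; rewrite /Ex /Rintegral -fineM; last 2 first.
- exact: integrable_fin_num.
- exact: integrable_fin_num.
congr fine.
rewrite (freezing (f := fun c c' => (g c * h c')%:E) mX mY XY); last first.
  by move=> c c'; rewrite lee_fin mulr_ge0.
transitivity (\int[P]_w (((Ex (h \o Y)))%:E * (g (X w))%:E))%E.
  apply: eq_integral => w _; rewrite -Ex_EFin// -[RHS]muleC.
  rewrite -ge0_integralZl//.
  - by apply/measurable_EFinP; exact: (itg_mfun hi).
  - by move=> w' _; rewrite lee_fin /= h0.
  - by rewrite lee_fin g0.
rewrite ge0_integralZl//.
- by rewrite Ex_EFin// Ex_EFin// muleC.
- by apply/measurable_EFinP; exact: (itg_mfun gi).
- by move=> w' _; rewrite lee_fin /= g0.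
- by rewrite lee_fin; apply: Ex_ge0 => w; exact: h0.
Qed.

(** A lower bound on the expectation of [f c Y] for each constant [c] gives one
    on the expectation of [f X Y], as if conditioning on [X]. *)
Lemma Ex_freezing_le {C C' : countType} (X : T -> C) (Y : T -> C')
    (f : C -> C' -> R) (g : C -> R) :
  countable_rv X -> countable_rv Y -> independent_rv P X Y ->
  (forall c c', 0 <= f c c') -> (forall c, 0 <= g c) ->
  (forall c, itg (fun w => f c (Y w)) /\ g c <= Ex (fun w => f c (Y w))) ->
  itg (g \o X) -> itg (fun w => f (X w) (Y w)) ->
  Ex (g \o X) <= Ex (fun w => f (X w) (Y w)).
Proof.
move=> mX mY XY f0 g0 fg gi fi; rewrite -lee_fin -!Ex_EFin//.
rewrite (freezing (f := fun c c' => (f c c')%:E) mX mY XY); last first.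
  by move=> c c'; rewrite lee_fin.
apply: ge0_le_integral => //.
- by move=> w _; rewrite lee_fin /= g0.
- by apply/measurable_EFinP; exact: (itg_mfun gi).
- exact: (@measurable_countable_rv _ _ _ _ _ X
    (fun c => \int[P]_w' (f c (Y w'))%:E)%E).
- by move=> w _; have [fi' gf] := fg (X w); rewrite Ex_EFin// lee_fin.
Qed.

End RealExpectation.

(** * Independence of events from families of primitives *)

Lemma preimage_ffun {T : Type} {I : finType} {C : Type} (X : I -> T -> C)
    (c : {ffun I -> C}) :
  (fun w => [ffun i => X i w]) @^-1` [set c] =
  \big[setI/setT]_(i <- enum I) (X i @^-1` [set c i]).
Proof.
rewrite -bigcap_seq; apply/seteqP; split=> w /=.
  by move=> <- i _ /=; rewrite ffunE.
move=> h; apply/ffunP => i; rewrite ffunE.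
by apply: (h i) => /=; rewrite mem_enum.
Qed.

Lemma countable_rv_ffun {d : measure_display} {T : measurableType d}
    {I : finType} {C : countType} (X : I -> T -> C) :
  (forall i, countable_rv (X i)) -> countable_rv (fun w => [ffun i => X i w]).
Proof.
move=> mX c; rewrite preimage_ffun; apply: bigsetI_measurable => i _.
exact: mX.
Qed.

Section Independence.
Context {R : realType} {d dE : measure_display}.
Context {T : measurableType d} {P : probability T R} {E : measurableType dE}.
Context {N : nat} {lambda : 'rV[R]_N} {p : 'I_N -> R}.
Context {Q0 : 'I_N -> T -> nat} {A : nat -> 'I_N -> T -> nat}.
Context {S : nat -> 'I_N -> T -> bool} {U : nat -> T -> E}.
Hypothesis model : on_off_model P lambda p Q0 A S U.

Local Notation events := (primitive_events Q0 A S U).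

Lemma countable_rv_init i : countable_rv (Q0 i).
Proof.
move=> c; rewrite -[X in measurable X]setTI.
exact: (measurable_init model).
Qed.

Lemma countable_rv_arrival t i : countable_rv (A t i).
Proof.
move=> c; rewrite -[X in measurable X]setTI.
exact: (measurable_arrival model).
Qed.

Lemma countable_rv_channel t i : countable_rv (S t i).
Proof.
move=> c; rewrite -[X in measurable X]setTI.
exact: (measurable_channel model).
Qed.

Lemma measurable_primitive_event x B : events x B -> measurable B.
Proof.
case: x => [|t i|t i|t] [C mC <-].
- have e w : (fun i => Q0 i w) = [ffun i => Q0 i w] :> ('I_N -> nat).
    by apply/funext => i; rewrite ffunE.
  have -> : (fun w i => Q0 i w) @^-1` C =
      (fun w => [ffun i => Q0 i w]) @^-1` [set q : {ffun 'I_N -> nat} | C q].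
    by apply/seteqP; split=> w; rewrite /preimage/= -e.
  exact/countable_rv_preimage/countable_rv_ffun/countable_rv_init.
- exact/countable_rv_preimage/countable_rv_arrival.
- exact/countable_rv_preimage/countable_rv_channel.
- by rewrite -[X in measurable X]setTI; exact: (measurable_seed model).
Qed.

(** [H] is an event that is independent of any finite family of events
    generated by distinct primitives of [F]. *)
Definition indep_from (F : pred (primitive N)) (H : set T) : Prop :=
  measurable H /\ forall (J : seq (primitive N)) (B : primitive N -> set T),
    uniq J -> (forall j, j \in J -> F j) ->
    (forall j, j \in J -> events j (B j)) ->
    P (H `&` \big[setI/setT]_(j <- J) B j) =
      (P H * \prod_(j <- J) P (B j))%E.

Lemma indep_from_setT : indep_from xpredT setT.
Proof.
split=> // J B uJ _ JB; rewrite setTI.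
rewrite (primitives_independent model)//.
by rewrite [X in (X * _)%E](_ : _ = 1%E) ?mul1e//; exact: probability_setT.
Qed.

(** Intersecting [H] with events generated by primitives of [F] costs only the
    independence from these primitives. *)
Lemma indep_from_setI (F F' : pred (primitive N)) H L B0 :
  indep_from F H -> uniq L -> (forall j, j \in L -> F j) ->
  (forall j, j \in L -> events j (B0 j)) ->
  (forall x, F' x -> F x && (x \notin L)) ->
  indep_from F' (H `&` \big[setI/setT]_(j <- L) B0 j).
Proof.
move=> [mH iH] uL LF LB F'F; split.
  apply: measurableI => //; rewrite big_seq_cond.
  apply: bigsetI_measurable => j /andP[jL _].
  exact: measurable_primitive_event (LB j jL).
move=> J B uJ JF JB.
(* One family of events on the disjoint lists L and J. *)
pose B' j := if j \in L then B0 j else B j.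
have JL j : j \in J -> j \in L = false.
  by move=> /JF /F'F /andP[_ /negbTE].
have -> : \big[setI/setT]_(j <- L) B0 j = \big[setI/setT]_(j <- L) B' j.
  by apply: eq_big_seq => j jL; rewrite /B' jL.
have -> : \big[setI/setT]_(j <- J) B j = \big[setI/setT]_(j <- J) B' j.
  by apply: eq_big_seq => j jJ; rewrite /B' JL.
have -> : (\prod_(j <- J) P (B j) = \prod_(j <- J) P (B' j))%E.
  by apply: eq_big_seq => j jJ; rewrite /B' JL.
rewrite -setIA -big_cat iH.
- rewrite iH//; first by rewrite big_cat /= muleA.
  by move=> j jL; rewrite /B' jL; exact: LB.
- rewrite cat_uniq uL uJ andbT /=; apply/hasPn => j jJ /=.
  by rewrite JL.
- by move=> j; rewrite mem_cat => /orP[/LF//|/JF/F'F/andP[]].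
- move=> j; rewrite mem_cat /B' => jLJ; case: ifPn => jL; first exact: LB.
  by move: jLJ; rewrite (negbTE jL); exact: JB.
Qed.

(** A countable union of the disjoint level sets of [X] inherits their
    independence. *)
Lemma indep_from_countable {C : countType} (X : T -> C) (F : pred (primitive N))
    (B : set C) :
  (forall c, indep_from F (X @^-1` [set c])) -> indep_from F (X @^-1` B).
Proof.
move=> iX; have mX : countable_rv X by move=> c; exact: (iX c).1.
have mXB : measurable (X @^-1` B) by exact: countable_rv_preimage.
split=> // J Bj uJ JF JB.
set G := \big[setI/setT]_(j <- J) Bj j.
have PG : P G = (\prod_(j <- J) P (Bj j))%E.
  exact: (primitives_independent model).
have mG : measurable G.
  rewrite /G big_seq_cond; apply: bigsetI_measurable => j /andP[jJ _].
  exact: measurable_primitive_event (JB j jJ).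
(* Both sides are integrals of the indicator of B composed with X. *)
have := @integral_indep_event R d T P C X G (fun c => (\1_B c)%:E) mX mG.
rewrite -PG muleC.
have e D : measurable D ->
    (\int[P]_(w in D) (\1_B (X w))%:E)%E = P (X @^-1` B `&` D).
  move=> mD; rewrite -integral_indic//; exact: eq_integral.
rewrite !e// setIT => -> // c.
  by rewrite setIC (iX c).2// -PG muleC.
Qed.

Lemma indep_from_rv {C C' : countType} (X : T -> C) (F : pred (primitive N)) x
    (Y : T -> C') :
  (forall c, indep_from F (X @^-1` [set c])) -> F x ->
  (forall c, events x (Y @^-1` [set c])) -> independent_rv P X Y.
Proof.
move=> iX Fx xY c c'; have := (iX c).2 [:: x] (fun=> Y @^-1` [set c']).
rewrite !big_seq1; apply=> //.
  by move=> j; rewrite inE => /eqP ->.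
by move=> j; rewrite inE => /eqP ->.
Qed.

(** A choice of one event per channel of slot [t], as a family indexed by all
    primitives; the value at the other primitives is irrelevant. Likewise for
    arrivals below. *)
Definition channel_event t (s : 'I_N -> set bool) (x : primitive N) : set T :=
  if x is Channel _ i then S t i @^-1` s i else setT.

Definition arrival_event t (a : 'I_N -> set nat) (x : primitive N) : set T :=
  if x is Arrival _ i then A t i @^-1` a i else setT.

Lemma uniq_channel t (r : seq 'I_N) : uniq r -> uniq (map (Channel t) r).
Proof. by move=> ur; rewrite map_inj_uniq// => i j []. Qed.

Lemma uniq_arrival t (r : seq 'I_N) : uniq r -> uniq (map (Arrival t) r).
Proof. by move=> ur; rewrite map_inj_uniq// => i j []. Qed.

Lemma channel_eventP t s x (r : seq 'I_N) :
  x \in map (Channel t) r -> events x (channel_event t s x).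
Proof. by move=> /mapP[i _ ->]; exists (s i). Qed.

Lemma arrival_eventP t s x (r : seq 'I_N) :
  x \in map (Arrival t) r -> events x (arrival_event t s x).
Proof. by move=> /mapP[i _ ->]; exists (s i). Qed.

Lemma independent_arrivals t i j : i != j -> independent_rv P (A t i) (A t j).
Proof.
move=> ij c c'.
have := primitives_independent model (J := [:: Arrival t i; Arrival t j])
  (B := arrival_event t (fun k => if k == i then [set c] else [set c'])).
rewrite !big_cons !big_nil /= setIT mule1 eqxx eq_sym (negbTE ij); apply.
  by rewrite inE /= andbT; apply/eqP => -[]; exact/eqP.
move=> x xJ; apply: (@arrival_eventP _ _ _ [:: i; j]); exact: xJ.
Qed.

Lemma channels_off t (r : seq 'I_N) : uniq r ->
  P [set w | forall i, i \in r -> S t i w = false] =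
    (\prod_(i <- r) (1 - p i))%:E.
Proof.
move=> ur; pose B := channel_event t (fun=> [set false]).
have -> : [set w | forall i, i \in r -> S t i w = false] =
    \big[setI/setT]_(x <- map (Channel t) r) B x.
  by rewrite big_map -bigcap_seq; apply/seteqP; split=> w /= h i; exact: h.
rewrite (primitives_independent model); last 2 first.
- exact: uniq_channel.
- by move=> x; exact: channel_eventP.
rewrite big_map -prodEFin; apply: eq_bigr => i _.
have -> : B (Channel t i) = ~` [set w | S t i w].
  by apply/seteqP; split=> w /=; [move=> ->|move=> /negP/negbTE].
rewrite probability_setC; first by rewrite (channel_on model).
have -> : [set w | S t i w] = S t i @^-1` [set true].
  by apply/seteqP; split=> w /=.
exact: countable_rv_channel.
Qed.

End Independence.

(** * The state of the queues is independent of the future *)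

(** The primitives of the slots from [t] on. *)
Definition future {N : nat} (t : nat) : pred (primitive N) := fun x =>
  match x with
  | Init => false
  | Arrival s _ | Channel s _ | Seed s => (t <= s)%N
  end.

(** The primitives of the slots from [t] on, except the channels of slot [t]. *)
Definition after_channels {N : nat} (t : nat) : pred (primitive N) := fun x =>
  match x with
  | Init => false
  | Channel s _ => (t < s)%N
  | Arrival s _ | Seed s => (t <= s)%N
  end.

(** The primitives of the slots from [t] on, except the channels and the seed of
    slot [t], that is, those that remain once a link is selected. *)
Definition after_selection {N : nat} (t : nat) : pred (primitive N) := fun x =>
  match x with
  | Init => false
  | Channel s _ | Seed s => (t < s)%N
  | Arrival s _ => (t <= s)%N
  end.

Section State.
Context {R : realType} {d dE : measure_display}.
Context {T : measurableType d} {P : probability T R} {E : measurableType dE}.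
Context {N : nat} {lambda : 'rV[R]_N} {p : 'I_N -> R}.
Context {Q0 : 'I_N -> T -> nat} {A : nat -> 'I_N -> T -> nat}.
Context {S : nat -> 'I_N -> T -> bool} {U : nat -> T -> E}.
Context {tie : ('I_N -> nat) -> ('I_N -> bool) -> E -> 'I_N}.
Context {Q : nat -> 'I_N -> T -> nat}.
Hypothesis model : on_off_model P lambda p Q0 A S U.
Hypothesis tie_lcq : lcq_rule tie.
Hypothesis dynamics : queue_dynamics Q0 A S (lcq_selection tie S U Q) Q.

Local Notation indep_from := (@indep_from R d dE T P E N Q0 A S U).

(** The backlogs, channel states and arrivals of slot [t] as finite functions,
    which form a countable type. *)
Definition backlogs t w : {ffun 'I_N -> nat} := [ffun i => Q t i w].
Definition channels t w : {ffun 'I_N -> bool} := [ffun i => S t i w].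
Definition selected t w : 'I_N := tie (Q t ^~ w) (S t ^~ w) (U t w).
Definition arrivals t w : {ffun 'I_N -> nat} := [ffun i => A t i w].
(** What the controller observes on slot [t]; [decided] adds its decision. *)
Definition observed t w := (backlogs t w, channels t w).
Definition decided t w := (observed t w, selected t w).

Lemma indep_observed t :
  (forall q, indep_from (future t) (backlogs t @^-1` [set q])) ->
  forall c, indep_from (after_channels t) (observed t @^-1` [set c]).
Proof.
move=> iq [q s].
pose B := @channel_event d T N S t (fun i => [set s i]).
have -> : observed t @^-1` [set (q, s)] = backlogs t @^-1` [set q] `&`
    \big[setI/setT]_(x <- map (Channel t) (enum 'I_N)) B x.
  rewrite big_map -preimage_ffun; apply/seteqP.
  by split=> w; rewrite /preimage/= /observed; [case=> -> <-|case=> -> <-].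
apply: (indep_from_setI model (F := future t)) => //.
- exact/uniq_channel/enum_uniq.
- by move=> x /mapP[i _ ->] /=.
- by move=> x; exact: channel_eventP.
- move=> [|s' i|s' i|s'] //= ts.
  + by rewrite ts; apply/mapP => -[].
  + rewrite ltnW//=; apply/mapP => -[j _ [E1 _]].
    by move: ts; rewrite E1 ltnn.
  + by rewrite ts; apply/mapP => -[].
Qed.

Lemma indep_decided t :
  (forall q, indep_from (future t) (backlogs t @^-1` [set q])) ->
  forall c, indep_from (after_selection t) (decided t @^-1` [set c]).
Proof.
move=> iq [[q s] j].
pose B (x : primitive N) : set T := U t @^-1` [set u | tie q s u = j].
have -> : decided t @^-1` [set (q, s, j)] = observed t @^-1` [set (q, s)] `&`
    \big[setI/setT]_(x <- [:: Seed t]) B x.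
  rewrite big_seq1; apply/seteqP.
  split=> w; rewrite /preimage/= /decided /observed /B/= /selected.
    case=> <- <- <-; split=> //.
    by congr (tie _ _ _); apply/funext => i; rewrite ffunE.
  case=> -[<- <-] <-; congr (_, _).
  by congr (tie _ _ _); apply/funext => i; rewrite ffunE.
apply: (indep_from_setI model (F := after_channels t)) => //.
- exact: indep_observed.
- by move=> x; rewrite inE => /eqP -> /=.
- move=> x; rewrite inE => /eqP -> /=.
  by exists [set u | tie q s u = j] => //; exact: tie_lcq.1.
- move=> [|s' i|s' i|s'] //= ts; rewrite ?ts ?(ltnW ts) /= inE; apply/eqP => //.
  by case=> E1; move: ts; rewrite E1 ltnn.
Qed.

Lemma indep_backlogs t q : indep_from (future t) (backlogs t @^-1` [set q]).
Proof.
elim: t q => [|t IH] q.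
  pose B (x : primitive N) : set T := backlogs 0 @^-1` [set q].
  have -> : backlogs 0 @^-1` [set q] =
      setT `&` \big[setI/setT]_(x <- [:: Init]) B x by rewrite big_seq1 setTI.
  apply: (indep_from_setI model (F := xpredT)) => //.
  - exact: (indep_from_setT model).
  - move=> x; rewrite inE => /eqP -> /=.
    exists [set (q : 'I_N -> nat)]; first by [].
    apply/seteqP; split=> w; rewrite /preimage/= /B /backlogs/=.
      by move=> e; apply/ffunP => i; rewrite ffunE dynamics.1 -e.
    by move=> <-; apply/funext => i; rewrite ffunE dynamics.1.
  - by move=> [|s' i|s' i|s'] //= _; rewrite inE; apply/eqP.
pose Z w := (decided t w, arrivals t w).
pose step (c : {ffun 'I_N -> nat} * {ffun 'I_N -> bool} * 'I_N *
    {ffun 'I_N -> nat}) : {ffun 'I_N -> nat} :=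
  [ffun i => (c.1.1.1 i - nat_of_bool (c.1.1.2 i && (c.1.2 == i)) + c.2 i)%N].
have -> : backlogs t.+1 @^-1` [set q] = Z @^-1` [set c | step c = q].
  have e w : backlogs t.+1 w = step (Z w).
    by apply/ffunP => i; rewrite !ffunE/= dynamics.2.
  by apply/seteqP; split=> w; rewrite /preimage/= e.
apply: (indep_from_countable model) => -[c a].
pose B := @arrival_event d T N A t (fun i => [set a i]).
have -> : Z @^-1` [set (c, a)] = decided t @^-1` [set c] `&`
    \big[setI/setT]_(x <- map (Arrival t) (enum 'I_N)) B x.
  rewrite big_map -preimage_ffun; apply/seteqP.
  by split=> w; rewrite /preimage/= /Z; [case=> -> <-|case=> -> <-].
apply: (indep_from_setI model (F := after_selection t)).
- exact: indep_decided.
- exact/uniq_arrival/enum_uniq.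
- by move=> x /mapP[i _ ->] /=.
- by move=> x; exact: arrival_eventP.
- move=> [|s' i|s' i|s'] //= ts.
  + rewrite ltnW//=; apply/mapP => -[j _ [E1 _]].
    by move: ts; rewrite E1 ltnn.
  + by rewrite ts; apply/mapP => -[].
  + by rewrite ts; apply/mapP => -[].
Qed.

Lemma countable_rv_backlogs t : countable_rv (backlogs t).
Proof. by move=> q; exact: (indep_backlogs t q).1. Qed.

Lemma countable_rv_channels t : countable_rv (channels t).
Proof. exact/countable_rv_ffun/(countable_rv_channel model). Qed.

Lemma countable_rv_decided t : countable_rv (decided t).
Proof. by move=> c; exact: (indep_decided (indep_backlogs t) c).1. Qed.

Lemma independent_decided_arrival t i :
  independent_rv P (decided t) (A t i).
Proof.
apply: (indep_from_rv (Q0 := Q0) (A := A) (S := S) (U := U)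
  (F := after_selection t) (x := Arrival t i)).
- by move=> c; exact: (indep_decided (indep_backlogs t) c).
- exact: leqnn.
- by move=> c; exists [set c].
Qed.

Lemma independent_backlogs_channels t :
  independent_rv P (backlogs t) (channels t).
Proof.
move=> q s.
pose B := @channel_event d T N S t (fun i => [set s i]).
have -> : channels t @^-1` [set s] =
    \big[setI/setT]_(x <- map (Channel t) (enum 'I_N)) B x.
  by rewrite big_map -preimage_ffun.
have ex x : x \in map (Channel t) (enum 'I_N) ->
    primitive_events Q0 A S U x (B x).
  exact: channel_eventP.
have uc : uniq (map (@Channel N t) (enum 'I_N)) by exact/uniq_channel/enum_uniq.
rewrite (indep_backlogs t q).2//; last by move=> x /mapP[i _ ->] /=.
by rewrite (primitives_independent model).
Qed.

End State.

(** * Deterministic inequalities *)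

(** Here [q] is the probability that a link is OFF, and [1 - q ^+ n] the
    probability that one of [n] such independent links is ON. *)
Section Coverage.
Context {R : realType}.
Variable q : R.
Hypothesis q01 : 0 <= q <= 1.

Let q_ge0 : 0 <= q. Proof. by have /andP[] := q01. Qed.
Let q_le1 : q <= 1. Proof. by have /andP[] := q01. Qed.

Lemma coverage_mono m n : (m <= n)%N -> 1 - q ^+ m <= 1 - q ^+ n.
Proof. by move=> mn; rewrite lerD2l lerN2 ler_wiXn2l. Qed.

(** Each of the [m] terms of the geometric sum [(1 - q ^+ m) / (1 - q)] is at
    least [q ^+ m]. *)
Lemma coverage_tangent m : m%:R * q ^+ m * (1 - q) <= 1 - q ^+ m.
Proof.
elim: m => [|m IH]; first by rewrite !mul0r expr0 subrr.
have qm : 0 <= q ^+ m <= 1 by rewrite exprn_ge0//= exprn_ile1.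
rewrite -natr1 exprS; set x := q ^+ m in IH qm *.
have := q_ge0; have := q_le1; move: qm => /andP[x0 x1] q1 q0.
have h1 : q * (m%:R * x * (1 - q)) <= q * (1 - x) by rewrite ler_wpM2l.
have h2 : 0 <= (1 - q) * (1 - q * x).
  by rewrite mulr_ge0 ?subr_ge0// mulr_ile1.
nra.
Qed.

(** [(1 - q ^+ n) / n] is nonincreasing in [n]. *)
Lemma coverage_concave m n : (m <= n)%N ->
  m%:R * (1 - q ^+ n) <= n%:R * (1 - q ^+ m).
Proof.
elim: n => [|n IH]; first by rewrite leqn0 => /eqP ->.
rewrite leq_eqVlt => /predU1P[->//|]; rewrite ltnS => mn.
have {}IH := IH mn; have tg := coverage_tangent m.
have qnm : q ^+ n <= q ^+ m by rewrite ler_wiXn2l.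
have h : m%:R * (1 - q) * q ^+ n <= m%:R * (1 - q) * q ^+ m.
  by rewrite ler_wpM2l// mulr_ge0// subr_ge0.
rewrite -natr1 exprS; nra.
Qed.

(** The deterministic core of the service estimate; [n m] stands for the number
    of queues with more than [m] packets, and [n0] for the number of nonempty
    queues. *)
Lemma coverage_bound (K N n0 M : nat) (n : nat -> nat) (z Nh : R) :
  (0 < K)%N -> 0 <= z <= 1 -> 0 < Nh -> N%:R <= Nh ->
  1 - z + z / Nh = K%:R^-1 ->
  (n0 <= N)%N -> (forall m, n m <= n0)%N ->
  (\sum_(m < M) (n m)%:R) / K%:R * (1 - q ^+ K) <=
  (1 - z) * (\sum_(m < M) (n m)%:R) * (1 - q ^+ n0)
  + z * \sum_(m < M) (1 - q ^+ n m).
Proof.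
move=> K0 /andP[z0 z1] Nh0 NNh zE n0N nn0.
have KR : 0 < K%:R :> R by rewrite ltr0n.
set s := \sum_(m < M) (n m)%:R.
have s0 : 0 <= s by rewrite /s sumr_ge0.
have c0 k : 0 <= 1 - q ^+ k by rewrite subr_ge0 exprn_ile1.
have [n00|n0_gt0] := posnP n0.
  have -> : s = 0.
    by rewrite /s big1// => m _; have := nn0 m; rewrite n00 leqn0 => /eqP ->.
  by rewrite mul0r mulr0 !mul0r add0r mulr_ge0// sumr_ge0.
have n0R : 0 < n0%:R :> R by rewrite ltr0n.
set f := 1 - q ^+ n0; have f0 : 0 <= f by exact: c0.
have h1 : s * f <= n0%:R * \sum_(m < M) (1 - q ^+ n m).
  by rewrite /s mulr_suml mulr_sumr ler_sum// => m _; exact: coverage_concave.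
(* It remains to compare phi n0 / n0 and phi n0 with phi K / K. *)
have h2 : K%:R^-1 * (1 - q ^+ K) <= (1 - z) * f + z * (f / n0%:R).
  (* Few nonempty queues: concavity; many: monotonicity and n0 <= N^. *)
  have [n0K|Kn0] := leqP n0 K.
    have cc : K%:R^-1 * (1 - q ^+ K) <= f / n0%:R.
      rewrite ler_pdivlMr// -mulrA mulrC ler_pdivrMr// mulrC [_ * K%:R]mulrC.
      exact: coverage_concave.
    have : f / n0%:R <= f by rewrite ler_pdivrMr// ler_peMr// ler1n.
    set a := f / n0%:R in cc *; set b := K%:R^-1 * _ in cc *.
    by move=> af; nra.
  have fK : 1 - q ^+ K <= f by apply: coverage_mono; exact: ltnW.
  rewrite -zE.
  apply: (@le_trans _ _ ((1 - z + z / Nh) * f)).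
    by rewrite ler_wpM2l// zE invr_ge0 ltW.
  rewrite mulrDl lerD2l -!mulrA ler_wpM2l// mulrC ler_wpM2l//.
  by rewrite lef_pV2 ?posrE// (le_trans _ NNh)// ler_nat.
rewrite -mulrA; apply: (@le_trans _ _ (s * ((1 - z) * f + z * (f / n0%:R)))).
  by rewrite ler_wpM2l.
rewrite mulrDr; apply: lerD; first by rewrite mulrA [s * _]mulrC.
rewrite mulrCA ler_wpM2l// mulrA ler_pdivrMr// mulrC; move: h1.
by rewrite [n0%:R * _]mulrC [s * f]mulrC.
Qed.

End Coverage.

Lemma nat_layers (x M : nat) : (x <= M)%N -> (\sum_(m < M) (m < x) = x)%N.
Proof.
move=> xM; rewrite -(big_mkord xpredT (fun m => nat_of_bool (m < x)%N)).
rewrite (big_cat_nat (n := x))//=.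
rewrite big_nat (eq_bigr (fun=> 1%N)); last by move=> i /andP[_ ->].
rewrite -big_nat sum_nat_const_nat subn0 muln1.
rewrite big_nat big1 ?addn0// => i /andP[xi _].
by rewrite ltnNge xi.
Qed.

(** Counting packets layer by layer instead of queue by queue. *)
Lemma sum_layers {N : nat} (q : 'I_N -> nat) (M : nat) :
  (forall i, q i <= M)%N ->
  (\sum_(i < N) q i = \sum_(m < M) #|[set i | m < q i]%SET|)%N.
Proof.
move=> qM; rewrite -(eq_bigr _ (fun i _ => nat_layers (qM i))) exchange_big /=.
apply: eq_bigr => m _; rewrite -sum1_card [RHS]big_mkcond /=.
by apply: eq_bigr => i _; rewrite inE; case: (_ < _)%N.
Qed.

Section Constants.
Context {R : realType} {N K : nat}.
Hypothesis K0 : (0 < K)%N.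
Hypothesis KN : (K <= N)%N.
Let Nh := @N_hat R N K.
Let z := @z_coef R N K.
Let KR : 0 < K%:R :> R. Proof. by rewrite ltr0n. Qed.

Lemma N_hat_ge : N%:R <= Nh.
Proof.
rewrite /Nh /N_hat -ler_pdivrMr//; exact: Num.Theory.ceil_ge.
Qed.

Lemma N_hat_geK : K%:R <= Nh.
Proof. by rewrite (le_trans _ N_hat_ge)// ler_nat. Qed.

Lemma N_hat_gt0 : 0 < Nh.
Proof. exact: lt_le_trans N_hat_geK. Qed.

Lemma N_hat_dvd : (K %| N)%N -> Nh = N%:R.
Proof.
rewrite /Nh /N_hat => /dvdnP[m ->]; rewrite natrM mulfK ?gt_eqF//.
by rewrite pmulrn Num.Theory.intrKceil.
Qed.

(** By the identity, equal rates [lambda_tot / Nh] contribute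
    [lambda_tot / K] times the total backlog to the weighted drift. *)
Lemma z_coef_bounds : 0 <= z <= 1 /\ 1 - z + z / Nh = K%:R^-1.
Proof.
rewrite /z /z_coef; case: eqP => [->|/eqP K1].
  by rewrite lexx ler01 subr0 mul0r addr0 invr1.
have K2 : (1 < K)%N by rewrite ltn_neqAle eq_sym K1.
have Nh1 : 1 < Nh by apply: lt_le_trans N_hat_geK; rewrite ltr1n.
have iK : K%:R^-1 <= 1 :> R by rewrite invf_le1// ler1n.
have iN : Nh^-1 < 1 by rewrite invf_lt1// N_hat_gt0.
have iNK : Nh^-1 <= K%:R^-1 by rewrite lef_pV2 ?posrE// ?N_hat_gt0// N_hat_geK.
have D0 : 0 < 1 - Nh^-1 by rewrite subr_gt0.
rewrite -/Nh; split.
  rewrite divr_ge0 ?subr_ge0//= ?(ltW iN)//.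
  by rewrite ler_pdivrMr// mul1r lerD2l lerN2.
set a := K%:R^-1; set b := Nh^-1 in D0 *; field.
by rewrite gt_eqF.
Qed.

End Constants.

(** * Moments of backlogs, arrivals and departures *)

Lemma integral_nat_rv {R : realType} {d : measure_display}
    {T : measurableType d} (P : probability T R) (X : T -> nat)
    (h : nat -> \bar R) :
  countable_rv X -> (forall k, 0 <= h k)%E ->
  (\int[P]_w h (X w) = \sum_(k <oo) h k * P (X @^-1` [set k]))%E.
Proof.
move=> mX h0; rewrite (@integral_fiber _ _ _ _ _ X)//; last first.
  exact: (@measurable_countable_rv _ _ _ _ _ X h).
apply: eq_eseriesr => k _; rewrite setTI.
rewrite -[RHS]integral_cst//.
have -> : fiber X k = X @^-1` [set k] by [].
by apply: eq_integral => w /[!inE] /= ->.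
Qed.

Section OneSlot.
Context {R : realType} {d dE : measure_display}.
Context {T : measurableType d} {P : probability T R} {E : measurableType dE}.
Context {N : nat} {lambda : 'rV[R]_N} {p : 'I_N -> R}.
Context {Q0 : 'I_N -> T -> nat} {A : nat -> 'I_N -> T -> nat}.
Context {S : nat -> 'I_N -> T -> bool} {U : nat -> T -> E}.
Context {tie : ('I_N -> nat) -> ('I_N -> bool) -> E -> 'I_N}.
Context {Q : nat -> 'I_N -> T -> nat}.
Hypothesis model : on_off_model P lambda p Q0 A S U.
Hypothesis tie_lcq : lcq_rule tie.
Hypothesis dynamics : queue_dynamics Q0 A S (lcq_selection tie S U Q) Q.

Local Notation itg := (itg P).
Local Notation sqitg := (sqitg P).
Local Notation Ex := (Ex P).
Local Notation decided := (@decided d dE T E N S U tie Q).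
Local Notation selected := (@selected d dE T E N S U tie Q).

(** Backlogs, arrivals and departures as real random variables, and their sums
    over the links. *)
Definition q_ t i w : R := (Q t i w)%:R.
Definition a_ t i w : R := (A t i w)%:R.
(** Link [i] transmits a packet on slot [t]. *)
Definition served t i w : bool :=
  S t i w && (selected t w == i) && (0 < Q t i w)%N.
Definition d_ t i w : R := (nat_of_bool (served t i w))%:R.
Definition qt t w : R := \sum_(i < N) q_ t i w.
Definition at_ t w : R := \sum_(i < N) a_ t i w.
Definition dt t w : R := \sum_(i < N) d_ t i w.

Lemma arrival_mfun t i : measurable_fun setT (a_ t i).
Proof.
exact: (measurable_countable_rv (fun n : nat => n%:R : R)
  (countable_rv_arrival model t i)).
Qed.

Lemma sqitg_arrival t i : sqitg (a_ t i).
Proof.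
split; first exact: arrival_mfun.
apply: itg_ge0 => [|w|]; first exact/measurable_funX/arrival_mfun.
  exact: sqr_ge0.
by have := arrival_second_moment model t i; rewrite unlock.
Qed.

Lemma Ex_arrival t i : Ex (a_ t i) = lambda ord0 i.
Proof.
apply: EFin_inj; rewrite -Ex_EFin; last exact/sqitg_itg/sqitg_arrival.
by have := arrival_mean model t i; rewrite unlock.
Qed.

Lemma backlog_decided t i w : Q t i w = (decided t w).1.1 i.
Proof. by rewrite ffunE. Qed.

Lemma channel_decided t i w : S t i w = (decided t w).1.2 i.
Proof. by rewrite ffunE. Qed.

Lemma decided_mfun t (f : T -> R) (g : _ -> R) :
  (forall w, f w = g (decided t w)) -> measurable_fun setT f.
Proof.
move=> fg; have -> : f = g \o decided t by apply/funext.
exact/measurable_countable_rv/(countable_rv_decided model tie_lcq dynamics).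
Qed.

Lemma backlog_mfun t i : measurable_fun setT (q_ t i).
Proof.
apply: (@decided_mfun t _ (fun c => (c.1.1 i)%:R)) => w.
by rewrite /q_ backlog_decided.
Qed.

(** [served] as a function of the observations and of the decision. *)
Definition served_of (c : {ffun 'I_N -> nat} * {ffun 'I_N -> bool} * 'I_N) i :=
  c.1.2 i && (c.2 == i) && (0 < c.1.1 i)%N.

Lemma served_decided t i w : served t i w = served_of (decided t w) i.
Proof. by rewrite /served /served_of -backlog_decided -channel_decided. Qed.

Lemma departure_mfun t i : measurable_fun setT (d_ t i).
Proof.
apply: (@decided_mfun t _ (fun c => (nat_of_bool (served_of c i))%:R)) => w.
by rewrite /d_ served_decided.
Qed.

(** With departures instead of offered service, no truncation is needed. *)
Lemma backlog_step t i w : q_ t.+1 i w = q_ t i w - d_ t i w + a_ t i w.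
Proof.
rewrite /q_ dynamics.2 natrD; congr (_ + _).
rewrite /lcq_selection -/(selected t w).
have -> : (S t i w && (Some (selected t w) == Some i)) =
  (S t i w && (selected t w == i)) by [].
rewrite /d_ /served; case: (S t i w && _) => /=; last by rewrite subn0 subr0.
case: posnP => [->|Q_gt0]; first by rewrite sub0n subr0.
by rewrite natrB.
Qed.

Lemma sqitg_departure t i : sqitg (d_ t i).
Proof.
apply: (@sqitg_le _ _ _ _ _ (fun=> 1)); first exact: departure_mfun.
  by move=> w; rewrite /d_; case: served; rewrite ?ler01 ?lexx.
exact: sqitg_cst.
Qed.

Lemma sqitg_backlog t i : sqitg (q_ t i).
Proof.
elim: t => [|t IH].
  split; first exact: backlog_mfun.
  apply: itg_ge0 => [|w|]; first exact/measurable_funX/backlog_mfun.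
    exact: sqr_ge0.
  have := init_second_moment model i; rewrite unlock.
  by under eq_integral => w _ do rewrite -dynamics.1.
apply: (@sqitg_le _ _ _ _ _ (fun w => q_ t i w + a_ t i w)).
- exact: backlog_mfun.
- move=> w; rewrite ler0n/= backlog_step lerD2r gerBl.
  exact: ler0n.
- by apply: sqitgD => //; exact: sqitg_arrival.
Qed.

(** The arrivals of slot [t] are uncorrelated with any nonnegative
    integrable function of the observations and of the decision of slot [t]. *)
Lemma Ex_mul_arrival t i (f : T -> R) (g : _ -> R) :
  (forall w, f w = g (decided t w)) -> (forall c, 0 <= g c) -> itg f ->
  Ex (fun w => f w * a_ t i w) = Ex f * lambda ord0 i.
Proof.
move=> fg g0; have -> : f = g \o decided t by apply/funext.
move=> fi; rewrite -(Ex_arrival t i).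
apply: (@Ex_indep_mul _ _ _ _ _ _ (decided t) (A t i) g (fun n => n%:R)) => //.
- exact: (countable_rv_decided model tie_lcq dynamics).
- exact: (countable_rv_arrival model).
- exact: (independent_decided_arrival model tie_lcq dynamics).
- exact/sqitg_itg/sqitg_arrival.
Qed.

Lemma Ex_backlog_arrival t i j :
  Ex (fun w => q_ t i w * a_ t j w) = Ex (q_ t i) * lambda ord0 j.
Proof.
apply: (@Ex_mul_arrival _ _ _ (fun c => (c.1.1 i)%:R)) => [w|c|].
- by rewrite /q_ backlog_decided.
- exact: ler0n.
- exact/sqitg_itg/sqitg_backlog.
Qed.

Lemma Ex_departure_arrival t i j :
  Ex (fun w => d_ t i w * a_ t j w) = Ex (d_ t i) * lambda ord0 j.
Proof.
apply: (@Ex_mul_arrival _ _ _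
  (fun c => (nat_of_bool (served_of c i))%:R)) => [w|c|].
- by rewrite /d_ served_decided.
- exact: ler0n.
- exact/sqitg_itg/sqitg_departure.
Qed.

Lemma Ex_arrival_sqr t i :
  Ex (fun w => a_ t i w ^+ 2) = Ex (fun w => a_ 0 i w ^+ 2).
Proof.
apply: EFin_inj; rewrite -!Ex_EFin; [|exact: (sqitg_arrival _ _).2..].
rewrite (@integral_nat_rv _ _ _ P (A t i)
  (fun k => (k%:R ^+ 2)%:E)); last 2 first.
- exact: (countable_rv_arrival model).
- by move=> k; rewrite lee_fin sqr_ge0.
rewrite (@integral_nat_rv _ _ _ P (A 0 i)
  (fun k => (k%:R ^+ 2)%:E)); last 2 first.
- exact: (countable_rv_arrival model).
- by move=> k; rewrite lee_fin sqr_ge0.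
apply: eq_eseriesr => k _; congr (_ * _)%E.
exact: (arrival_identically_distributed model).
Qed.

Lemma Ex_arrivals_mul t i j : i != j ->
  Ex (fun w => a_ t i w * a_ t j w) = lambda ord0 i * lambda ord0 j.
Proof.
move=> ij; rewrite -(Ex_arrival t i) -(Ex_arrival t j).
apply: (@Ex_indep_mul _ _ _ _ _ _ (A t i) (A t j)
  (fun n => n%:R) (fun n => n%:R)) => //.
- exact: (countable_rv_arrival model).
- exact: (countable_rv_arrival model).
- exact: (independent_arrivals model).
- exact/sqitg_itg/sqitg_arrival.
- exact/sqitg_itg/sqitg_arrival.
Qed.

Lemma Ex_sum_mul (I J : finType) (f : I -> T -> R) (g : J -> T -> R) :
  (forall i, sqitg (f i)) -> (forall j, sqitg (g j)) ->
  Ex (fun w => (\sum_i f i w) * (\sum_j g j w)) =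
  \sum_i \sum_j Ex (fun w => f i w * g j w).
Proof.
move=> fi gi; under [in LHS]eq_fun => w do rewrite mulr_suml.
rewrite Ex_sum; last by move=> i; apply: sqitg_mul => //; exact: sqitg_sum.
apply: eq_bigr => i _; under [in LHS]eq_fun => w do rewrite mulr_sumr.
by rewrite Ex_sum// => j; exact: sqitg_mul.
Qed.

Lemma Ex_total_arrivals_sqr t :
  Ex (fun w => at_ t w ^+ 2) =
  \sum_i \sum_j (if i == j then Ex (fun w => a_ 0 i w ^+ 2)
                 else lambda ord0 i * lambda ord0 j).
Proof.
under [in LHS]eq_fun => w do rewrite expr2 /at_.
rewrite Ex_sum_mul; [|exact: sqitg_arrival..].
apply: eq_bigr => i _; apply: eq_bigr => j _.
case: eqP => [<-|/eqP ij]; last exact: Ex_arrivals_mul.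
by under eq_fun => w do rewrite -expr2; exact: Ex_arrival_sqr.
Qed.

End OneSlot.

(** * One-slot drift of the Lyapunov function *)

Lemma Ex_sqr_step {R : realType} {d : measure_display} {T : measurableType d}
    (P : probability T R) (x a b : T -> R) :
  sqitg P x -> sqitg P a -> sqitg P b -> (forall w, b w ^+ 2 = b w) ->
  Ex P (fun w => (x w - b w + a w) ^+ 2) =
  Ex P (fun w => x w ^+ 2) + (Ex P b + Ex P (fun w => a w ^+ 2)
    - 2 * Ex P (fun w => b w * a w) + 2 * Ex P (fun w => x w * a w)
    - 2 * Ex P (fun w => x w * b w)).
Proof.
move=> sx sa sb bb.
have -> : (fun w => (x w - b w + a w) ^+ 2) =
  (fun w => x w ^+ 2 + (b w + a w ^+ 2 - 2 * (b w * a w) + 2 * (x w * a w)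
     - 2 * (x w * b w))).
  by apply/funext => w; rewrite -[X in _ = _ + (X + _ - _ + _ - _)]bb; ring.
have ib := sqitg_itg sb; have ixx := sx.2; have iaa := sa.2.
have iba := itgZ 2 (sqitg_mul sb sa).
have ixa := itgZ 2 (sqitg_mul sx sa).
have ixb := itgZ 2 (sqitg_mul sx sb).
have i1 := itgD ib iaa; have i2 := itgB i1 iba; have i3 := itgD i2 ixa.
have i4 := itgB i3 ixb.
rewrite ExD// ExB// ExD// ExB// ExD// !ExZ//.
- exact: sqitg_mul.
- exact: sqitg_mul.
- exact: sqitg_mul.
Qed.

Section Drift.
Context {R : realType} {d dE : measure_display}.
Context {T : measurableType d} {P : probability T R} {E : measurableType dE}.
Context {N : nat} {lambda : 'rV[R]_N} {p : 'I_N -> R}.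
Context {Q0 : 'I_N -> T -> nat} {A : nat -> 'I_N -> T -> nat}.
Context {S : nat -> 'I_N -> T -> bool} {U : nat -> T -> E}.
Context {tie : ('I_N -> nat) -> ('I_N -> bool) -> E -> 'I_N}.
Context {Q : nat -> 'I_N -> T -> nat}.
Hypothesis model : on_off_model P lambda p Q0 A S U.
Hypothesis pmin_gt0 : 0 < p_min p.
Hypothesis pmin_lt1 : p_min p < 1.
Hypothesis tie_lcq : lcq_rule tie.
Hypothesis dynamics : queue_dynamics Q0 A S (lcq_selection tie S U Q) Q.

Local Notation itg := (itg P).
Local Notation sqitg := (sqitg P).
Local Notation Ex := (Ex P).
Local Notation selected := (@selected d dE T E N S U tie Q).
Local Notation served := (@served d dE T E N S U tie Q).
Local Notation backlogs := (@backlogs d T N Q).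
Local Notation channels := (@channels d T N S).
Local Notation q_ := (@q_ R d T N Q).
Local Notation a_ := (@a_ R d T N A).
Local Notation d_ := (@d_ R d dE T E N S U tie Q).
Local Notation qt := (@qt R d T N Q).
Local Notation at_ := (@at_ R d T N A).
Local Notation dt := (@dt R d dE T E N S U tie Q).
Local Notation pm := (p_min p).

Let sq_q t i : sqitg (q_ t i).
Proof. exact: (sqitg_backlog model tie_lcq dynamics). Qed.
Let sq_a t i : sqitg (a_ t i).
Proof. exact: (sqitg_arrival model). Qed.
Let sq_d t i : sqitg (d_ t i).
Proof. exact: (sqitg_departure model tie_lcq dynamics). Qed.
Let sq_qt t : sqitg (qt t). Proof. exact: sqitg_sum. Qed.
Let sq_at t : sqitg (at_ t). Proof. exact: sqitg_sum. Qed.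
Let sq_dt t : sqitg (dt t). Proof. exact: sqitg_sum. Qed.

Lemma p_min_le i : pm <= p i.
Proof. exact: bigmin_le. Qed.

Lemma p_le1 i : p i <= 1.
Proof.
rewrite -lee_fin -(channel_on model 0 i); apply: probability_le1.
exact: (countable_rv_channel model 0 i true).
Qed.

(** The indicator that some link of [L] is ON. *)
Definition some_on (L : {set 'I_N}) (s : {ffun 'I_N -> bool}) : R :=
  (nat_of_bool [exists i, (i \in L) && s i])%:R.

Lemma some_on01 L s : 0 <= some_on L s <= 1.
Proof. by rewrite /some_on; case: [exists _, _]; rewrite ?lexx ?ler01. Qed.

Lemma sqitg_some_on t L : sqitg (fun w => some_on L (channels t w)).
Proof.
apply: (@sqitg_le _ _ _ _ _ (fun=> 1)); last exact: sqitg_cst.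
  exact: (measurable_countable_rv (some_on L) (countable_rv_channels model t)).
by move=> w; exact: some_on01.
Qed.

Lemma Ex_some_on t (L : {set 'I_N}) :
  1 - (1 - pm) ^+ #|L| <= Ex (fun w => some_on L (channels t w)).
Proof.
pose off := [set w | forall i, i \in enum L -> S t i w = false].
have moff : measurable off.
  have -> : off = channels t @^-1`
      [set s | forall i, i \in enum L -> s i = false].
    by apply/seteqP; split=> w; rewrite /preimage/= => h i iL;
      have := h i iL; rewrite ffunE.
  exact/countable_rv_preimage/(countable_rv_channels model).
have -> : (fun w => some_on L (channels t w)) = (fun w => 1 - \1_off w).
  apply/funext => w; rewrite /some_on indicE.
  case: existsP => [[i /andP[iL]]|h].
    rewrite ffunE => Si; rewrite memNset ?subr0// => /(_ i).
    by rewrite mem_enum Si => /(_ iL).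
  rewrite mem_set ?subrr// => i; rewrite mem_enum => iL.
  by apply/negbTE/negP => Si; apply: h; exists i; rewrite iL ffunE.
have ioff : itg (\1_off).
  apply: itg_ge0 => //.
  by rewrite integral_indic// setIT ltey_eq fin_num_measure.
rewrite ExB//; last exact: itg_cst.
have -> : Ex \1_off = \prod_(i <- enum L) (1 - p i).
  apply: EFin_inj; rewrite -Ex_EFin// integral_indic// setIT.
  exact: (channels_off model t (enum_uniq _)).
rewrite Ex_cst lerD2l lerN2.
rewrite (big_enum _ _ _ (fun i => 1 - p i))/= -prodr_const.
apply: ler_prod => i _; rewrite subr_ge0 p_le1 /=.
by rewrite lerD2l lerN2 p_min_le.
Qed.

(** The queues with more than [m] packets. *)
Definition level (c : {ffun 'I_N -> nat}) (m : nat) : {set 'I_N} :=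
  [set i | (m < c i)%N].
Definition total (c : {ffun 'I_N -> nat}) : nat := (\sum_(i < N) c i)%N.

(** A lower bound, in terms of backlogs and channel states only, on the weighted
    service of the LCQ policy; this form makes its expectation over the channel
    states immediate. *)
Definition rate_lower (z : R) (c : {ffun 'I_N -> nat})
    (s : {ffun 'I_N -> bool}) : R :=
  (1 - z) * (total c)%:R * some_on (level c 0) s
  + z * \sum_(m < total c) some_on (level c m) s.

Lemma total_ge (c : {ffun 'I_N -> nat}) i : (c i <= total c)%N.
Proof. by rewrite /total (bigD1 i)//= leq_addr. Qed.

(** Only the selected link can transmit. *)
Lemma departures_selected t w (f : 'I_N -> R) :
  \sum_i f i * d_ t i w =
  f (selected t w) * (nat_of_bool (served t (selected t w) w))%:R.
Proof.
rewrite (bigD1 (selected t w))//= big1 ?addr0// => i.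
by rewrite eq_sym /d_ /served => /negbTE ->; rewrite andbF mulr0.
Qed.

Lemma dtE t w : dt t w = (nat_of_bool (served t (selected t w) w))%:R.
Proof.
rewrite /dt; under eq_bigr => i _ do rewrite -[d_ _ _ _]mul1r.
by rewrite (departures_selected t w (fun=> 1)) mul1r.
Qed.

Lemma dt_sqr t w : dt t w ^+ 2 = dt t w.
Proof. by rewrite dtE; case: served; rewrite ?expr1n ?expr0n. Qed.

Lemma d_sqr t i w : d_ t i w ^+ 2 = d_ t i w.
Proof. by rewrite /d_; case: served; rewrite ?expr1n ?expr0n. Qed.

(** A selected link that is ON but empty has weight 0, so discarding empty links
    does not change the weight served. *)
Lemma served_weight t w (j := selected t w) :
  (Q t j w * served t j w = Q t j w * S t j w)%N.
Proof.
rewrite /served eqxx andbT; case: (S t j w) => //=.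
by case: posnP => [->|].
Qed.

(** The LCQ rule: the weight of the selected link exceeds [m] as soon as some
    connected queue does. *)
Lemma some_on_weight t w m (j := selected t w) :
  some_on (level (backlogs t w) m) (channels t w) <=
  (nat_of_bool (m < Q t j w * S t j w)%N)%:R.
Proof.
rewrite /some_on ler_nat; case: existsP => [[i]|_]; last by case: (_ < _)%N.
rewrite inE !ffunE => /andP[mQ Si]; suff -> : (m < Q t j w * S t j w)%N by [].
apply: leq_trans (tie_lcq.2 (Q t ^~ w) (S t ^~ w) (U t w) i).
by rewrite Si muln1.
Qed.

Lemma rate_lower_le (z : R) t w : 0 <= z <= 1 ->
  rate_lower z (backlogs t w) (channels t w) <=
  (1 - z) * (qt t w * dt t w) + z * \sum_i q_ t i w * d_ t i w.
Proof.
move=> /andP[z0 z1]; set j := selected t w.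
have qtE : qt t w = (total (backlogs t w))%:R.
  by rewrite /qt /total natr_sum; apply: eq_bigr => i _; rewrite ffunE.
rewrite /rate_lower; apply: lerD.
  rewrite -mulrA qtE ler_wpM2l ?subr_ge0// ler_wpM2l// dtE.
  apply: le_trans (some_on_weight t w 0) _; rewrite ler_nat -/j.
  rewrite -served_weight; case: (served _ _ _); first exact: leq_b1.
  by rewrite muln0.
rewrite ler_wpM2l// departures_selected -/j /q_ -natrM served_weight.
have xM : (Q t j w * S t j w <= total (backlogs t w))%N.
  apply: leq_trans (total_ge _ j); rewrite ffunE.
  by case: (S t j w); rewrite ?muln1 ?muln0.
rewrite -[in leRHS](nat_layers xM) natr_sum ler_sum// => m _.
exact: some_on_weight.
Qed.

Lemma rate_lower_ge0 (z : R) c s : 0 <= z <= 1 -> 0 <= rate_lower z c s.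
Proof.
move=> /andP[z0 z1]; rewrite addr_ge0// ?mulr_ge0// ?subr_ge0//.
by apply: sumr_ge0 => m _; have /andP[] := some_on01 (level c m) s.
Qed.

Variable K : nat.
Hypothesis K0 : (0 < K)%N.
Hypothesis KN : (K <= N)%N.
Local Notation z := (@z_coef R N K).

Lemma Ex_rate_lower t c :
  itg (fun w => rate_lower z c (channels t w)) /\
  (total c)%:R / K%:R * (1 - (1 - pm) ^+ K) <=
  Ex (fun w => rate_lower z c (channels t w)).
Proof.
have [z01 zE] := @z_coef_bounds R N K K0 KN; have /andP[z0 z1] := z01.
have ion m : itg (fun w => some_on (level c m) (channels t w)).
  exact/sqitg_itg/sqitg_some_on.
have i1 := itgZ ((1 - z) * (total c)%:R) (ion 0).
have isum :
    itg (fun w => \sum_(m < total c) some_on (level c m) (channels t w)).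
  by apply: itg_sum => m.
have i2 := itgZ z isum.
split; first exact: itgD.
rewrite ExD// !ExZ// Ex_sum => [|m]; last exact: ion.
have totE : (total c)%:R = \sum_(m < total c) #|level c m|%:R :> R.
  rewrite -natr_sum; congr (_%:R).
  by rewrite [LHS](@sum_layers _ c (total c))// => i; exact: total_ge.
have q01 : 0 <= 1 - pm <= 1 by rewrite subr_ge0 gerBl !ltW.
have nn m : (#|level c m| <= #|level c 0|)%N.
  apply/subset_leq_card/fintype.subsetP => i; rewrite !inE.
  exact: leq_ltn_trans.
have nN : (#|level c 0%N| <= N)%N.
  by rewrite -[X in (_ <= X)%N]card_ord max_card.
have := @coverage_bound R (1 - pm) q01 K N #|level c 0| (total c)
  (fun m => #|level c m|) z (@N_hat R N K) K0 z01 (@N_hat_gt0 R N K K0 KN)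
  (@N_hat_ge R N K K0) zE nN nn.
rewrite -totE => /le_trans; apply; apply: lerD.
  by rewrite ler_wpM2l ?mulr_ge0 ?subr_ge0// Ex_some_on.
by rewrite ler_wpM2l// ler_sum// => m _; exact: Ex_some_on.
Qed.

(** The service estimate: the bound of [Ex_rate_lower] for frozen backlogs,
    averaged over the backlogs. *)
Lemma service_lower t :
  Ex (qt t) / K%:R * (1 - (1 - pm) ^+ K) <=
  (1 - z) * Ex (fun w => qt t w * dt t w)
  + z * \sum_i Ex (fun w => q_ t i w * d_ t i w).
Proof.
have [z01 zE] := @z_coef_bounds R N K K0 KN.
have iqd := sqitg_mul (sq_qt t) (sq_dt t).
have isum : itg (fun w => \sum_(i < N) q_ t i w * d_ t i w).
  by apply: itg_sum => i; exact: sqitg_mul.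
rewrite -Ex_sum => [|i]; last exact: sqitg_mul.
rewrite -(ExZ (1 - z) iqd) -(ExZ z isum).
have i1 := itgZ (1 - z) iqd; have i2 := itgZ z isum.
rewrite -ExD//.
have mb : countable_rv (backlogs t).
  exact: (countable_rv_backlogs model tie_lcq dynamics).
have mc : countable_rv (channels t) by exact: (countable_rv_channels model).
have irl : itg (fun w => rate_lower z (backlogs t w) (channels t w)).
  apply: itg_le (itgD i1 i2).
    exact: (measurable_countable_rv (fun c => rate_lower z c.1 c.2)
      (countable_rv_pair mb mc)).
  by move=> w; rewrite ger0_norm ?rate_lower_ge0// rate_lower_le.
apply: le_trans (Ex_le irl (itgD i1 i2) _); last first.
  by move=> w; exact: rate_lower_le.
pose g (c : {ffun 'I_N -> nat}) : R :=
  (total c)%:R / K%:R * (1 - (1 - pm) ^+ K).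
have gE : g \o backlogs t = (fun w => (K%:R^-1 * (1 - (1 - pm) ^+ K)) * qt t w).
  apply/funext => w; rewrite /g /= [RHS]mulrC mulrA; congr (_ / _ * _).
  by rewrite /qt /total natr_sum; apply: eq_bigr => i _; rewrite ffunE.
have -> : Ex (qt t) / K%:R * (1 - (1 - pm) ^+ K) = Ex (g \o backlogs t).
  by rewrite gE ExZ; [rewrite [RHS]mulrC mulrA|exact: sqitg_itg].
apply: (@Ex_freezing_le _ _ _ _ _ _ (backlogs t) (channels t)
  (rate_lower z) g) => //.
- exact: (independent_backlogs_channels model tie_lcq dynamics).
- by move=> c s; exact: rate_lower_ge0.
- move=> c; rewrite /g mulr_ge0// ?divr_ge0// subr_ge0 exprn_ile1//.
    by rewrite subr_ge0 ltW.
  by rewrite gerBl ltW.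
- by move=> c; exact: Ex_rate_lower.
- by rewrite gE; apply: itgZ; exact: sqitg_itg.
Qed.

(** The mean of the sum of squared group backlogs over all splittings into [K]
    groups. *)
Definition lyapunov t w : R := (1 - z) * qt t w ^+ 2 + z * \sum_i q_ t i w ^+ 2.

Lemma itg_lyapunov t : itg (lyapunov t).
Proof.
apply: itgD; apply: itgZ; first exact: (sq_qt t).2.
by apply: itg_sum => i; exact: (sq_q t i).2.
Qed.

Lemma Ex_lyapunov t : Ex (lyapunov t) =
  (1 - z) * Ex (fun w => qt t w ^+ 2) + z * \sum_i Ex (fun w => q_ t i w ^+ 2).
Proof.
rewrite ExD; last 2 first.
- by apply: itgZ; exact: (sq_qt t).2.
- by apply: itgZ; apply: itg_sum => i; exact: (sq_q t i).2.
have is2 : itg (fun w => \sum_(i < N) q_ t i w ^+ 2).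
  by apply: itg_sum => i; exact: (sq_q t i).2.
rewrite (ExZ _ (sq_qt t).2) (ExZ _ is2).
by rewrite Ex_sum// => i; exact: (sq_q t i).2.
Qed.

Lemma qt_step t w : qt t.+1 w = qt t w - dt t w + at_ t w.
Proof.
rewrite /qt /dt /at_ -sumrB -big_split; apply: eq_bigr => i _.
exact: (backlog_step dynamics).
Qed.

Lemma Ex_qt t : Ex (qt t) = \sum_i Ex (q_ t i).
Proof. by rewrite Ex_sum// => i; exact: sqitg_itg. Qed.

Lemma Ex_dt t : Ex (dt t) = \sum_i Ex (d_ t i).
Proof. by rewrite Ex_sum// => i; exact: sqitg_itg. Qed.

Lemma Ex_at t : Ex (at_ t) = lambda_tot lambda.
Proof.
rewrite Ex_sum => [|i]; last exact: sqitg_itg.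
by apply: eq_bigr => i _; exact: (Ex_arrival model).
Qed.

Lemma Ex_qt_step t : Ex (qt t.+1) = Ex (qt t) - Ex (dt t) + lambda_tot lambda.
Proof.
have iq := sqitg_itg (sq_qt t); have id_ := sqitg_itg (sq_dt t).
have ia := sqitg_itg (sq_at t).
rewrite -(Ex_at t) -ExB// -ExD//; last exact: itgB.
by congr (Ex _); apply/funext => w; exact: qt_step.
Qed.

(** Exact one-slot change of the Lyapunov function. Departures are 0 or 1, also
    in total, so they equal their squares. *)
Lemma Ex_lyapunov_step t : Ex (lyapunov t.+1) = Ex (lyapunov t)
  + (1 - z) * (Ex (dt t) + Ex (fun w => at_ t w ^+ 2)
     - 2 * (Ex (dt t) * lambda_tot lambda) + 2 * (Ex (qt t) * lambda_tot lambda)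
     - 2 * Ex (fun w => qt t w * dt t w))
  + z * \sum_i (Ex (d_ t i) + Ex (fun w => a_ t i w ^+ 2)
     - 2 * (Ex (d_ t i) * lambda ord0 i) + 2 * (Ex (q_ t i) * lambda ord0 i)
     - 2 * Ex (fun w => q_ t i w * d_ t i w)).
Proof.
rewrite !Ex_lyapunov.
have -> : (fun w => qt t.+1 w ^+ 2) =
    (fun w => (qt t w - dt t w + at_ t w) ^+ 2).
  by apply/funext => w; rewrite qt_step.
rewrite Ex_sqr_step//; last exact: dt_sqr.
have -> : Ex (fun w => dt t w * at_ t w) = Ex (dt t) * lambda_tot lambda.
  rewrite Ex_sum_mul// Ex_dt mulr_suml; apply: eq_bigr => i _.
  rewrite mulr_sumr; apply: eq_bigr => j _.
  exact: (Ex_departure_arrival model tie_lcq dynamics).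
have -> : Ex (fun w => qt t w * at_ t w) = Ex (qt t) * lambda_tot lambda.
  rewrite Ex_sum_mul// Ex_qt mulr_suml; apply: eq_bigr => i _.
  rewrite mulr_sumr; apply: eq_bigr => j _.
  exact: (Ex_backlog_arrival model tie_lcq dynamics).
have -> : \sum_i Ex (fun w => q_ t.+1 i w ^+ 2) =
    \sum_i Ex (fun w => q_ t i w ^+ 2) +
    \sum_i (Ex (d_ t i) + Ex (fun w => a_ t i w ^+ 2)
     - 2 * (Ex (d_ t i) * lambda ord0 i) + 2 * (Ex (q_ t i) * lambda ord0 i)
     - 2 * Ex (fun w => q_ t i w * d_ t i w)).
  rewrite -big_split; apply: eq_bigr => i _ /=.
  have -> : (fun w => q_ t.+1 i w ^+ 2) =
      (fun w => (q_ t i w - d_ t i w + a_ t i w) ^+ 2).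
    by apply/funext => w; rewrite (backlog_step dynamics).
  rewrite Ex_sqr_step//; last exact: d_sqr.
  rewrite (Ex_departure_arrival model tie_lcq dynamics).
  by rewrite (Ex_backlog_arrival model tie_lcq dynamics).
ring.
Qed.

End Drift.

(** * The capacity region and limits superior *)

Section LimSup.
Context {R : realType}.
Implicit Types u : (\bar R)^nat.
Local Open Scope ereal_scope.

Lemma limn_esupE u : limn_esup u = ereal_inf (range (esups u)).
Proof. by rewrite limn_esup_lim; apply/cvg_lim => //; exact: cvg_esups_inf. Qed.

Lemma limn_esup_lty u : limn_esup u < +oo ->
  exists (M : R) n, forall k, (n <= k)%N -> u k <= M%:E.
Proof.
rewrite limn_esupE => /ereal_inf_lt[_ [n _ <-] esn].
exists (fine (esups u n)), n => k nk.
have uk : u k <= esups u n by apply: ereal_sup_ubound; exists k.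
apply: le_trans uk _; move: esn; case: (esups u n) => [r| |] //=.
by rewrite leNye.
Qed.

(** A term of order 1 / t does not contribute to the limit superior. *)
Lemma limn_esup_le_lin u (C B : R) :
  (forall t, (0 < t)%N -> u t <= (C / t%:R + B)%:E) -> limn_esup u <= B%:E.
Proof.
move=> uCB; apply/lee_addgt0Pr => e e0; rewrite limn_esupE.
pose n := (Num.Def.archi_bound (`|C| / e)).+1.
apply: (@le_trans _ _ (esups u n)); first by apply: ereal_inf_lbound; exists n.
apply: ge_ereal_sup => _ [k nk <-].
have k0 : (0 < k)%N by apply: leq_trans nk.
apply: le_trans (uCB k k0) _; rewrite -EFinD lee_fin addrC lerD2l.
rewrite ler_pdivrMr ?ltr0n//; apply: (le_trans (ler_norm C)).
rewrite mulrC -ler_pdivrMr//; apply: ltW.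
apply: lt_le_trans (archi_boundP _) _; first by rewrite divr_ge0// ltW.
by rewrite ler_nat; apply: ltnW.
Qed.

End LimSup.

Lemma expectation_Ex {R : realType} {d : measure_display} {T : measurableType d}
    (P : probability T R) (f : T -> R) : itg P f -> 'E_P[f]%E = (Ex P f)%:E.
Proof. by move=> fi; rewrite unlock -Ex_EFin. Qed.

Section Capacity.
Context {R : realType} {N : nat}.
Variable p : 'I_N -> R.

(** If the total rate exceeded 1, the expected total backlog would grow at least
    linearly, whatever the control algorithm. *)
Lemma stabilizable_rate_le1 (lambda : 'rV[R]_N) :
  stabilizable p lambda -> lambda_tot lambda <= 1.
Proof.
move=> [d [dE [T [P [E [Q0 [A [S [U [phi [sel [Q]]]]]]]]]]]].
move=> [model _ msel [Q_0 Q_S] stable].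
have cA t i : countable_rv (A t i) by exact: (countable_rv_arrival model).
have mnat (f : T -> nat) :
    countable_rv f -> measurable_fun setT (fun w => (f w)%:R : R).
  exact: (measurable_countable_rv (fun n : nat => n%:R : R)).
have csel t i : countable_rv (fun w => sel t w == Some i).
  have m1 : measurable [set w | sel t w = Some i] by exact: msel.
  case; rewrite /preimage/=.
    have -> // : [set w | (sel t w == Some i) = true] =
        [set w | sel t w = Some i].
    by apply/seteqP; split=> w /=; [move/eqP|move=> ->; rewrite eqxx].
  have -> : [set w | (sel t w == Some i) = false] =
      ~` [set w | sel t w = Some i].
    apply/seteqP; split=> w /=; first by move=> /negbT/eqP.
    by move=> /eqP/negbTE.
  exact: measurableC.
have cQ t i : countable_rv (Q t i).
  elim: t => [|t IH].
    have -> : Q 0 i = Q0 i by apply/funext.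
    exact: (countable_rv_init model).
  have -> : Q t.+1 i =
      (fun c => c.1 - nat_of_bool (c.2.1 && c.2.2.1) + c.2.2.2)%N \o
      (fun w => (Q t i w, (S t i w, (sel t w == Some i, A t i w)))).
    by apply/funext => w /=; rewrite Q_S.
  apply: countable_rv_comp; apply: countable_rv_pair => //.
  apply: countable_rv_pair; first exact: (countable_rv_channel model).
  exact: countable_rv_pair.
have sA t i : sqitg P (fun w => (A t i w)%:R : R).
  exact: (sqitg_arrival model).
have sQ t i : sqitg P (fun w => (Q t i w)%:R : R).
  elim: t => [|t IH].
    split; first exact/mnat/cQ.
    apply: itg_ge0 => [|w|]; first exact/measurable_funX/mnat/cQ.
      exact: sqr_ge0.
    have := init_second_moment model i; rewrite unlock.
    by under eq_integral => w _ do rewrite -Q_0.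
  apply: (@sqitg_le _ _ _ _ _ (fun w => (Q t i w)%:R + (A t i w)%:R)).
  - exact/mnat/cQ.
  - by move=> w; rewrite ler0n/= -natrD ler_nat Q_S leq_add2r leq_subr.
  - exact: sqitgD.
pose x t := \sum_i Ex P (fun w => (Q t i w)%:R).
have iQ t i : itg P (fun w => (Q t i w)%:R : R) by exact/sqitg_itg/sQ.
have iA t i : itg P (fun w => (A t i w)%:R : R) by exact/sqitg_itg/sA.
(* One slot removes at most one packet from the whole system. *)
have x_step t : x t + lambda_tot lambda <= x t.+1 + 1.
  have -> : lambda_tot lambda = \sum_i Ex P (fun w => (A t i w)%:R).
    by apply: eq_bigr => i _; rewrite -(Ex_arrival model t i).
  rewrite /x -!Ex_sum// -ExD; [|exact: itg_sum..].
  rewrite -[X in _ + X](Ex_cst P) -ExD; [|exact: itg_sum|exact: itg_cst].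
  apply: Ex_le => [||w].
  - by apply: itgD; exact: itg_sum.
  - by apply: itgD; [exact: itg_sum|exact: itg_cst].
  rewrite -!natr_sum -natrD -[X in _ <= _ + X](_ : 1%:R = _)// -natrD ler_nat.
  pose mu i := nat_of_bool (S t i w && (sel t w == Some i)).
  have mu1 : (\sum_i mu i <= 1)%N.
    case sw : (sel t w) => [j|]; last first.
      by rewrite big1// => i _; rewrite /mu sw andbF.
    rewrite (bigD1 j)//= big1 ?addn0 /mu ?leq_b1// => i ij.
    rewrite sw; have -> : (Some j == Some i) = false; last by rewrite andbF.
    by apply/negbTE; apply: contraNN ij => /eqP[->].
  apply: leq_trans (leq_add (leqnn _) mu1); rewrite -!big_split /=.
  apply: leq_sum => i _; rewrite Q_S -/(mu i); lia.
have x0 t : 0 <= x t.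
  by apply: sumr_ge0 => i _; apply: Ex_ge0 => w; exact: ler0n.
have avgE i t : average_backlog P Q i t =
    (t%:R^-1 * \sum_(0 <= tau < t) Ex P (fun w => (Q tau i w)%:R))%:E.
  rewrite /average_backlog EFinM -sumEFin; congr (_ * _)%E.
  by apply: eq_bigr => tau _; exact: expectation_Ex.
rewrite leNgt; apply/negP => lam1; set e := lambda_tot lambda - 1.
have e0 : 0 < e by rewrite subr_gt0.
have x_lin t : t%:R * e <= x t.
  elim: t => [|t IH]; first by rewrite mul0r.
  have := x_step t; rewrite -natr1 mulrDl mul1r.
  have : lambda_tot lambda = e + 1 by rewrite /e subrK.
  by move=> ->; move: IH; lra.
(* The sum over the slots before t is then of order t^2. *)
have sum_lin t : (t%:R * (t%:R - 1)) * e <= 2 * \sum_(0 <= tau < t) x tau.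
  elim: t => [|t IH]; first by rewrite big_nil !mul0r mulr0.
  rewrite big_nat_recr//= [in leRHS]mulrDr.
  have := x_lin t; rewrite -natr1; move: IH; lra.
have bnd i : exists Mn : R * nat, forall k, (Mn.2 <= k)%N ->
    (average_backlog P Q i k <= Mn.1%:E)%E.
  by have [M [n h]] := limn_esup_lty (stable i); exists (M, n).
(* Strong stability bounds all the averages from some slot on. *)
have [f hf] := choice bnd.
pose n := (\sum_i (f i).2)%N; pose M := \sum_i (f i).1.
have key t : (n <= t)%N -> (0 < t)%N -> (t%:R - 1) * e <= 2 * M.
  move=> nt t0; have tR : 0 < t%:R :> R by rewrite ltr0n.
  have : \sum_(0 <= tau < t) x tau <= t%:R * M.
    rewrite exchange_big /M mulr_sumr; apply: ler_sum => i _.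
    have /hf : ((f i).2 <= t)%N.
      by apply: leq_trans nt; rewrite /n (bigD1 i)//= leq_addr.
    by rewrite avgE lee_fin mulrC ler_pdivrMr// mulrC.
  move=> h; have h2 := sum_lin t.
  rewrite -(ler_pM2l tR) mulrA; apply: le_trans h2 _.
  by rewrite mulrCA ler_pM2l.
pose t := (n + (Num.Def.archi_bound (2 * `|M| / e)).+2)%N.
have := key t (leq_addr _ _); rewrite /t addnS => /(_ isT).
rewrite -natr1 addrK leNgt => /negP; apply.
rewrite -ltr_pdivrMr//; apply: (@le_lt_trans _ _ (2 * `|M| / e)).
  by rewrite ler_pM2r ?invr_gt0// ler_pM2l// ler_norm.
apply: lt_le_trans (archi_boundP _) _.
  by rewrite divr_ge0 ?mulr_ge0// ltW.
by rewrite ler_nat addnS leqW// leq_addl.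
Qed.

Lemma lambda_tot_continuous : continuous (@lambda_tot R N).
Proof.
have h (r : seq 'I_N) : continuous (fun x : 'rV[R]_N => \sum_(i <- r) x ord0 i).
  elim: r => [|i r IH].
    under [X in continuous X]eq_fun => x do rewrite big_nil.
    exact: cst_continuous.
  under [X in continuous X]eq_fun => x do rewrite big_cons.
  move=> x; apply: continuousD; [exact: coord_continuous|exact: IH].
exact: h.
Qed.

Lemma capacity_rate_le1 (lambda : 'rV[R]_N) :
  capacity_region p lambda -> lambda_tot lambda <= 1.
Proof.
rewrite /capacity_region closureEbigcap => /(_ [set x | lambda_tot x <= 1]).
apply; split; last exact: stabilizable_rate_le1.
have -> : [set x : 'rV[R]_N | lambda_tot x <= 1] =
   @lambda_tot R N @^-1` [set y | y <= 1] by [].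
apply: preimage_closed; last exact: closed_le.
by move=> x _; exact: lambda_tot_continuous.
Qed.

End Capacity.

(** * The bounds on backlog and delay *)

(** Summation of the drift inequality: [v], [x] and [dl] are the expected
    Lyapunov function, total backlog and departures. The term [a * dl t], of
    either sign, is summed exactly by flow conservation; the remainder
    [a * x t] is absorbed by [v t]. *)
Lemma telescoping_drift {R : realType} (v x dl : nat -> R) (a b lam eps2 : R) :
  `|a| <= 1 -> (forall t, 0 <= x t) -> (forall t, x t <= v t) ->
  (forall t, x t.+1 = x t - dl t + lam) ->
  (forall t, v t.+1 <= v t + a * dl t + b - eps2 * x t) ->
  forall t, eps2 * \sum_(0 <= tau < t) x tau <=
    v 0 + x 0 + t%:R * (a * lam + b).
Proof.
move=> a1 x0 xv x_step v_step t.
have inv : eps2 * \sum_(0 <= tau < t) x tau + v t + a * x t <=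
    v 0 + a * x 0 + t%:R * (a * lam + b).
  elim: t => [|t IH]; first by rewrite big_nil mulr0 add0r mul0r addr0.
  rewrite big_nat_recr//= -natr1 x_step; have := v_step t; move: IH.
  rewrite !mulrDr !mulrDl; lra.
have ax t' : `|a * x t'| <= x t'.
  by rewrite normrM (ger0_norm (x0 t')) ler_piMl.
have := ax t; have := ax 0; have := xv t.
rewrite !ler_norml => h /andP[_ h0] /andP[h1 _]; move: inv; lra.
Qed.

(** By the recursion k pmf(k) = l pmf(k - 1), E[X^2] = l E[X + 1]. *)
Lemma poisson_second_moment {R : realType} {d : measure_display}
    {T : measurableType d} (P : probability T R) (X : T -> nat) (l : R) :
  0 < l -> countable_rv X -> itg P (fun w => (X w)%:R) ->
  Ex P (fun w => (X w)%:R) = l ->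
  itg P (fun w => (X w)%:R ^+ 2) ->
  (forall k, P [set w | X w = k] = (poisson_pmf l k)%:E) ->
  Ex P (fun w => (X w)%:R ^+ 2) = l + l ^+ 2.
Proof.
move=> l0 mX iX EX iX2 pX; apply: EFin_inj; rewrite -Ex_EFin//.
have pmf_shift k : k.+1%:R * poisson_pmf l k.+1 = l * poisson_pmf l k.
  rewrite /poisson_pmf l0 factS natrM exprS invfM.
  have k1 : k.+1%:R != 0 :> R by rewrite pnatr_eq0.
  have f0 : k`!%:R != 0 :> R by rewrite pnatr_eq0 -lt0n fact_gt0.
  move: k1 f0; move: (k.+1%:R) (k`!%:R) => y g k1 f0; field.
  by rewrite f0 k1.
rewrite (@integral_nat_rv _ _ _ P X (fun k => (k%:R ^+ 2)%:E)); last 2 first.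
- exact: mX.
- by move=> k; rewrite lee_fin sqr_ge0.
(* The term k = 0 vanishes; shift the others. *)
rewrite nneseries_recl//; last first.
  by move=> k _; rewrite mule_ge0// lee_fin sqr_ge0.
rewrite expr0n mul0e add0e.
transitivity (l%:E * \int[P]_w ((X w)%:R + 1)%:E)%E.
  rewrite (@integral_nat_rv _ _ _ P X (fun k => (k%:R + 1)%:E)); last 2 first.
  - exact: mX.
  - by move=> k; rewrite lee_fin addr_ge0.
  rewrite -nneseriesZl; last first.
    by move=> k _; rewrite mule_ge0// lee_fin addr_ge0.
  rewrite -(nneseries_addn 1%N).
    apply: eq_eseriesr => k _; rewrite addn1.
    have pXk j : P (X @^-1` [set j]) = (poisson_pmf l j)%:E by exact: pX.
    rewrite !pXk -!EFinM; congr (_%:E).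
    by rewrite expr2 -mulrA pmf_shift natr1; ring.
  by move=> k; rewrite mule_ge0// lee_fin sqr_ge0.
rewrite (Ex_EFin (itgD iX (itg_cst P 1))) ExD//; last exact: itg_cst.
by rewrite EX Ex_cst -EFinM mulrDr mulr1 addrC.
Qed.

Section DelayBounds.
Context {R : realType} {d dE : measure_display}.
Context {T : measurableType d} {P : probability T R} {E : measurableType dE}.
Context {N : nat} {lambda : 'rV[R]_N} {p : 'I_N -> R}.
Context {Q0 : 'I_N -> T -> nat} {A : nat -> 'I_N -> T -> nat}.
Context {S : nat -> 'I_N -> T -> bool} {U : nat -> T -> E}.
Context {tie : ('I_N -> nat) -> ('I_N -> bool) -> E -> 'I_N}.
Context {Q : nat -> 'I_N -> T -> nat} {rho : R} {K : nat}.
Hypothesis model : on_off_model P lambda p Q0 A S U.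
Hypothesis lambda_gt0 : forall i, 0 < lambda ord0 i.
Hypothesis pmin_gt0 : 0 < p_min p.
Hypothesis pmin_lt1 : p_min p < 1.
Hypothesis tie_lcq : lcq_rule tie.
Hypothesis dynamics : queue_dynamics Q0 A S (lcq_selection tie S U Q) Q.
Hypothesis rho_lt1 : rho < 1.
Hypothesis lambda_rho : lambda_tot lambda <= rho.
Hypothesis K0 : (0 < K)%N.
Hypothesis KN : (K <= N)%N.
Hypothesis K_large : (1 + rho) / 2 <= 1 - (1 - p_min p) ^+ K.

Local Notation Ex := (Ex P).
Local Notation q_ := (@q_ R d T N Q).
Local Notation a_ := (@a_ R d T N A).
Local Notation d_ := (@d_ R d dE T E N S U tie Q).
Local Notation qt := (@qt R d T N Q).
Local Notation at_ := (@at_ R d T N A).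
Local Notation dt := (@dt R d dE T E N S U tie Q).
Local Notation z := (@z_coef R N K).
Local Notation Nh := (@N_hat R N K).
Local Notation lam := (lambda_tot lambda).
Local Notation V := (@lyapunov R d T N Q K).

Let KR : 0 < K%:R :> R. Proof. by rewrite ltr0n. Qed.
Let sq_q t i : sqitg P (q_ t i).
Proof. exact: (sqitg_backlog model tie_lcq dynamics). Qed.
Let sq_a t i : sqitg P (a_ t i).
Proof. exact: (sqitg_arrival model). Qed.
Let sq_d t i : sqitg P (d_ t i).
Proof. exact: (sqitg_departure model tie_lcq dynamics). Qed.

Lemma lambda_tot_gt0 : 0 < lam.
Proof.
have N0 : (0 < N)%N by exact: leq_trans KN.
rewrite /lambda_tot (bigD1 (Ordinal N0))//= ltr_wpDr//.
by apply: sumr_ge0 => i _; exact/ltW.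
Qed.

(** The service and arrival estimates bound the part of the drift that is linear
    in the backlogs. *)
Lemma Ex_lyapunov_drift (beta : R) t : 0 <= beta ->
  rate_constraint lambda rho beta K ->
  Ex (V t.+1) <= Ex (V t)
  + (1 - z) * (Ex (dt t) + Ex (fun w => at_ t w ^+ 2) - 2 * (Ex (dt t) * lam))
  + z * \sum_i (Ex (d_ t i) + Ex (fun w => a_ t i w ^+ 2)
      - 2 * (Ex (d_ t i) * lambda ord0 i))
  - 2 * ((1 - rho) * (2^-1 - z * beta)) / K%:R * Ex (qt t).
Proof.
move=> beta0 rc; have [/andP[z0 z1] zE] := @z_coef_bounds R N K K0 KN.
rewrite (Ex_lyapunov_step model tie_lcq dynamics).
have sv := service_lower model pmin_gt0 pmin_lt1 tie_lcq dynamics K0 KN t.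
set x := Ex (qt t) in sv *; set dl := Ex (dt t).
set Ma := Ex (fun w => at_ t w ^+ 2).
set G := Ex (fun w => qt t w * dt t w) in sv *.
have x0 : 0 <= x by apply: Ex_ge0 => w; apply: sumr_ge0 => i _; exact: ler0n.
pose g i := Ex (fun w => q_ t i w * d_ t i w).
pose c i := Ex (d_ t i) + Ex (fun w => a_ t i w ^+ 2)
  - 2 * (Ex (d_ t i) * lambda ord0 i).
have -> : \sum_i (Ex (d_ t i) + Ex (fun w => a_ t i w ^+ 2) -
      2 * (Ex (d_ t i) * lambda ord0 i) + 2 * (Ex (q_ t i) * lambda ord0 i) -
      2 * Ex (fun w => q_ t i w * d_ t i w)) =
    \sum_i c i + 2 * \sum_i Ex (q_ t i) * lambda ord0 i - 2 * \sum_i g i.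
  by rewrite !mulr_sumr -big_split -sumrB.
have load : \sum_i Ex (q_ t i) * lambda ord0 i <=
    x * (lam / Nh + beta * (1 - rho) / K%:R).
  rewrite /x (Ex_qt model tie_lcq dynamics) mulr_suml ler_sum// => i _.
  by rewrite ler_wpM2l// ?rc//; apply: Ex_ge0 => w; exact: ler0n.
rewrite -/(\sum_i c i); set C := \sum_i c i.
set g' := \sum_i g i in sv *; set L := \sum_i _ in load *.
have xK : 0 <= x / K%:R by rewrite divr_ge0// ltW.
have sv2 : x / K%:R * ((1 + rho) / 2) <= (1 - z) * G + z * g'.
  by apply: le_trans sv; rewrite ler_wpM2l.
have load2 : (1 - z) * (x * lam) + z * L <=
    x / K%:R * (rho + z * beta * (1 - rho)).
  apply: (@le_trans _ _ (x / K%:R * (lam + z * beta * (1 - rho)))); last first.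
    by rewrite ler_wpM2l// lerD2r.
  have := ler_wpM2l z0 load => {}load.
  apply: le_trans (lerD (lexx _) load) _.
  suff -> : (1 - z) * (x * lam)
      + z * (x * (lam / Nh + beta * (1 - rho) / K%:R)) =
    x * ((1 - z + z / Nh) * lam + z * beta * (1 - rho) / K%:R).
    by rewrite zE; rewrite le_eqVlt; apply/orP; left; apply/eqP; ring.
  ring.
have -> : 2 * ((1 - rho) * (2^-1 - z * beta)) / K%:R * x =
  2 * (x / K%:R * ((1 + rho) / 2))
  - 2 * (x / K%:R * (rho + z * beta * (1 - rho))).
  by field; rewrite gt_eqF.
nra.
Qed.

(** Backlogs are integers, hence at most their squares. *)
Lemma backlog_le_lyapunov t w : qt t w <= V t w.
Proof.
have [/andP[z0 z1] _] := @z_coef_bounds R N K K0 KN.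
have nsq (n : nat) : n%:R <= n%:R ^+ 2 :> R.
  by rewrite -natrX ler_nat; case: n => // n; rewrite expnS leq_pmulr.
have qtE : qt t w = (\sum_i Q t i w)%:R by rewrite natr_sum.
have h1 : qt t w <= qt t w ^+ 2 by rewrite qtE nsq.
have h2 : qt t w <= \sum_i q_ t i w ^+ 2.
  by apply: ler_sum => i _; exact: nsq.
rewrite /lyapunov; nra.
Qed.

Lemma average_total_backlogE t :
  average_total_backlog P Q t = (t%:R^-1 * \sum_(0 <= tau < t) Ex (qt tau))%:E.
Proof.
rewrite /average_total_backlog EFinM -sumEFin; congr (_ * _)%E.
apply: eq_bigr => tau _; rewrite (Ex_qt model tie_lcq dynamics) -sumEFin.
apply: eq_bigr => i _; apply: expectation_Ex.
exact: (sqitg_itg (sq_q tau i)).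
Qed.

(** The time average backlog from a drift inequality; [a * lam + b] is the
    average of the constant term, [lam] being the long-run departure rate. *)
Lemma Qbar_tot_le (a b eps2 : R) : 0 < eps2 -> `|a| <= 1 ->
  (forall t, Ex (V t.+1) <= Ex (V t) + a * Ex (dt t) + b - eps2 * Ex (qt t)) ->
  (Qbar_tot P Q <= ((a * lam + b) / eps2)%:E)%E.
Proof.
move=> e0 a1 drift.
have iq t : itg P (qt t).
  by apply: sqitg_itg; apply: sqitg_sum => i; exact: sq_q.
have bound := @telescoping_drift R (fun t => Ex (V t)) (fun t => Ex (qt t))
  (fun t => Ex (dt t)) a b lam eps2 a1.
apply: (@limn_esup_le_lin _ _ ((Ex (V 0) + Ex (qt 0)) / eps2)) => t t0.
have tR : 0 < t%:R :> R by rewrite ltr0n.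
rewrite average_total_backlogE lee_fin mulrC ler_pdivrMr//.
rewrite -(ler_pM2l e0).
have -> : eps2 * (((Ex (V 0) + Ex (qt 0)) / eps2 / t%:R
    + (a * lam + b) / eps2) * t%:R)
  = Ex (V 0) + Ex (qt 0) + t%:R * (a * lam + b).
  by field; rewrite !gt_eqF.
apply: bound => // t'.
- by apply: Ex_ge0 => w; apply: sumr_ge0 => i _; exact: ler0n.
- apply: Ex_le => //; last by move=> w; exact: backlog_le_lyapunov.
  exact: (itg_lyapunov model tie_lcq dynamics).
- exact: (Ex_qt_step model tie_lcq dynamics).
Qed.

Lemma Wbar_le (B : R) : (Qbar_tot P Q <= B%:E)%E ->
  (Wbar P lambda Q <= (B / lam)%:E)%E.
Proof.
move=> h; rewrite /Wbar EFinM; apply: lee_wpmul2r => //.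
by rewrite lee_fin invr_ge0 ltW// lambda_tot_gt0.
Qed.

Local Notation Ma := (Ex (fun w => at_ 0 w ^+ 2)).

Lemma D_constE : D_const P lambda A = (2^-1 * (lam + Ma))%:E.
Proof.
rewrite /D_const EFinM EFinD; congr (_ * (_ + _))%E.
apply: expectation_Ex; apply: (proj2 (_ : sqitg P (at_ 0))).
by apply: sqitg_sum => i; exact: sq_a.
Qed.

(** The second moment of the total arrivals is determined by the individual
    second moments and the rates, none of which depends on the slot. *)
Lemma Ex_at_sqr t : Ex (fun w => at_ t w ^+ 2) = Ma.
Proof. by rewrite !(Ex_total_arrivals_sqr model). Qed.

Lemma lcq_backlog_delay_bound (beta : R) : beta_admissible lambda rho beta K ->
  let c := (1 - rho) * (2^-1 - z * beta) in
  (Qbar_tot P Q <= K%:R%:E * D_const P lambda A * c^-1%:E)%E /\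
  (Wbar P lambda Q <=
     K%:R%:E * (D_const P lambda A * lam^-1%:E) * c^-1%:E)%E.
Proof.
move=> [beta0 betaz rc] c.
have [/andP[z0 z1] zE] := @z_coef_bounds R N K K0 KN.
have zb : z * beta < 2^-1.
  move: betaz; rewrite /half_inv; case: eqP => [->|/eqP zn0].
    by rewrite mul0r invr_gt0.
  have z_gt0 : 0 < z by rewrite lt_neqAle eq_sym zn0.
  by rewrite lte_fin invfM ltr_pdivlMr// mulrC.
have c0 : 0 < c by rewrite mulr_gt0 ?subr_gt0.
have lam0 := lambda_tot_gt0.
suff h : (Qbar_tot P Q <= (K%:R * (2^-1 * (lam + Ma)) * c^-1)%:E)%E.
  rewrite D_constE -!EFinM; split=> //.
  have -> : K%:R * (2^-1 * (lam + Ma) * lam^-1) * c^-1 =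
    K%:R * (2^-1 * (lam + Ma)) * c^-1 / lam by ring.
  exact: Wbar_le.
have -> : K%:R * (2^-1 * (lam + Ma)) * c^-1 = (1 * lam + Ma) / (2 * c / K%:R).
  by field; rewrite !gt_eqF.
apply: Qbar_tot_le; first by rewrite divr_gt0// mulr_gt0.
  by rewrite normr1.
move=> t; apply: le_trans (Ex_lyapunov_drift t beta0 rc) _.
rewrite -/c lerD2r mul1r Ex_at_sqr.
have dl_ge0 i : 0 <= Ex (d_ t i) by apply: Ex_ge0 => w; exact: ler0n.
have dE' := Ex_dt model tie_lcq dynamics t.
set dl := Ex (dt t) in dE' *.
have dl0 : 0 <= dl by rewrite dE'; apply: sumr_ge0.
have sa : \sum_i Ex (fun w => a_ t i w ^+ 2) <= Ma.
  rewrite -(Ex_at_sqr t) -Ex_sum => [|i]; last exact: (sq_a t i).2.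
  apply: Ex_le; first by apply: itg_sum => i; exact: (sq_a t i).2.
    by apply: (proj2 (_ : sqitg P (at_ t))); apply: sqitg_sum => i; exact: sq_a.
  move=> w; rewrite expr2 mulr_suml; apply: ler_sum => i _.
  rewrite expr2 ler_wpM2l// /at_ (bigD1 i)//= lerDl sumr_ge0//.
have sc : \sum_i (Ex (d_ t i) + Ex (fun w => a_ t i w ^+ 2)
      - 2 * (Ex (d_ t i) * lambda ord0 i)) <= dl + Ma.
  apply: (@le_trans _ _ (\sum_i (Ex (d_ t i) + Ex (fun w => a_ t i w ^+ 2)))).
    apply: ler_sum => i _; rewrite gerBl mulr_ge0// mulr_ge0//.
    exact/ltW.
  by rewrite big_split /= -dE' lerD2l.
have hd : 0 <= dl * lam by rewrite mulr_ge0// ltW.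
have h1 : (1 - z) * (dl + Ma - 2 * (dl * lam)) <= (1 - z) * (dl + Ma).
  by rewrite ler_wpM2l ?subr_ge0// gerBl mulr_ge0.
have h2 := ler_wpM2l z0 sc.
move: h1 h2; rewrite mulrBl mul1r => h1 h2; lra.
Qed.

Lemma lcq_uniform_poisson_bound : (K %| N)%N ->
  (forall i, lambda ord0 i = lam / N%:R) -> poisson_arrivals P lambda A ->
  [/\ beta_admissible lambda rho 0 K,
      (Qbar_tot P Q <=
         ((2 * K%:R * lam - lam ^+ 2) / (1 - rho))%:E)%E
    & (Wbar P lambda Q <= ((2 * K%:R - lam) / (1 - rho))%:E)%E].
Proof.
move=> KdN unif pois.
have [/andP[z0 z1] zE] := @z_coef_bounds R N K K0 KN.
have NhE := @N_hat_dvd R N K K0 KdN; rewrite NhE in zE.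
have N0 : (0 < N)%N by exact: leq_trans KN.
have NR : 0 < N%:R :> R by rewrite ltr0n.
have lam0 := lambda_tot_gt0.
have adm : beta_admissible lambda rho 0 K.
  split=> //.
  - rewrite /half_inv; case: eqP => [_|/eqP zn0]; first exact: ltry.
    by rewrite lte_fin invr_gt0 mulr_gt0// lt_neqAle eq_sym zn0.
  - by move=> i; rewrite NhE !mul0r addr0 unif.
have rho1 : 0 < 1 - rho by rewrite subr_gt0.
suff h : (Qbar_tot P Q <= ((2 * K%:R * lam - lam ^+ 2) / (1 - rho))%:E)%E.
  split=> //; have -> : (2 * K%:R - lam) / (1 - rho) =
    (2 * K%:R * lam - lam ^+ 2) / (1 - rho) / lam.
    by field; rewrite !gt_eqF.
  exact: Wbar_le.
have [beta0 _ rc] := adm.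
have m2 t i : Ex (fun w => a_ t i w ^+ 2) = lam / N%:R + (lam / N%:R) ^+ 2.
  rewrite -(unif i); apply: poisson_second_moment => //.
  - exact: (countable_rv_arrival model).
  - exact: (sqitg_itg (sq_a t i)).
  - exact: (Ex_arrival model).
  - exact: (sq_a t i).2.
have MaE : Ma = lam + lam ^+ 2.
  rewrite (Ex_total_arrivals_sqr model).
  have -> : lam + lam ^+ 2 =
      \sum_i (lambda ord0 i + \sum_j lambda ord0 i * lambda ord0 j).
    rewrite big_split /= -/lam; congr (_ + _).
    by rewrite expr2 mulr_suml; apply: eq_bigr => i _; rewrite mulr_sumr.
  apply: eq_bigr => i _; rewrite (bigD1 i)//= [in RHS](bigD1 i)//= eqxx m2.
  rewrite unif -addrA; congr (_ + (_ + _)).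
  by apply: eq_bigr => j; rewrite eq_sym => /negbTE ->.
have Kge1 : 1 <= K%:R :> R by rewrite ler1n.
(* The weights (1 - z) and z of the total and individual terms recombine into
   1 - z + z / N = 1 / K, both for the departures and for the arrivals. *)
pose a := 1 - 2 * lam / K%:R; pose b := lam + lam ^+ 2 / K%:R.
have -> : (2 * K%:R * lam - lam ^+ 2) / (1 - rho) =
   (a * lam + b) / (2 * ((1 - rho) * (2^-1 - z * 0)) / K%:R).
  rewrite mulr0 subr0 /a /b; field.
  by rewrite !gt_eqF.
apply: Qbar_tot_le.
- by rewrite mulr0 subr0 divr_gt0// mulr_gt0// mulr_gt0// invr_gt0.
- have lK : lam / K%:R <= 1.
    rewrite ler_pdivrMr// mul1r.
    by apply: le_trans (le_trans (ltW rho_lt1) Kge1).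
  have lK0 : 0 <= lam / K%:R by rewrite divr_ge0// ltW.
  by rewrite /a ler_norml -mulrA; apply/andP; split; lra.
move=> t; apply: le_trans (Ex_lyapunov_drift t beta0 rc) _.
rewrite lerD2r Ex_at_sqr MaE.
have dE' := Ex_dt model tie_lcq dynamics t.
set dl := Ex (dt t) in dE' *.
have -> : \sum_i (Ex (d_ t i) + Ex (fun w => a_ t i w ^+ 2)
      - 2 * (Ex (d_ t i) * lambda ord0 i)) =
    dl + (lam + lam ^+ 2 / N%:R) - 2 * (dl * lam) / N%:R.
  rewrite dE' big_split /= big_split /=; congr (_ + _ + _).
    rewrite (eq_bigr _ (fun i _ => m2 t i)) sumr_const card_ord -mulr_natl.
    by field; rewrite gt_eqF.
  rewrite sumrN; congr (- _); rewrite -mulr_sumr -!mulrA; congr (_ * _).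
  by rewrite mulr_suml; apply: eq_bigr => i _; rewrite unif.
have -> : a * dl = dl - 2 * (dl * lam) * K%:R^-1 by rewrite /a; ring.
have -> : b = lam + lam ^+ 2 * K%:R^-1 by [].
by rewrite -zE; rewrite le_eqVlt; apply/orP; left; apply/eqP; ring.
Qed.

End DelayBounds.

Theorem theorem3 (R : realType) (d dE : measure_display)
    (T : measurableType d) (P : probability T R) (E : measurableType dE)
    (N : nat) (lambda : 'rV[R]_N) (p : 'I_N -> R)
    (Q0 : 'I_N -> T -> nat) (A : nat -> 'I_N -> T -> nat)
    (S : nat -> 'I_N -> T -> bool) (U : nat -> T -> E)
    (tie : ('I_N -> nat) -> ('I_N -> bool) -> E -> 'I_N)
    (Q : nat -> 'I_N -> T -> nat) (rho : R) (K : nat)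
    (model : on_off_model P lambda p Q0 A S U)
    (lambda_gt0 : forall i, 0 < lambda ord0 i)
    (pmin_gt0 : 0 < p_min p) (pmin_lt1 : p_min p < 1)
    (tie_lcq : lcq_rule tie)
    (dynamics : queue_dynamics Q0 A S (lcq_selection tie S U Q) Q)
    (rho_gt0 : 0 < rho) (rho_lt1 : rho < 1)
    (lambda_rho : [set rho *: x | x in capacity_region p] lambda)
    (K_smallest : is_smallest_K (p_min p) rho K) (K_le_N : (K <= N)%N) :
  (forall beta : R, beta_admissible lambda rho beta K ->
     let c := (1 - rho) * (2^-1 - z_coef (N := N) K * beta) in
     (Qbar_tot P Q <= K%:R%:E * D_const P lambda A * c^-1%:E)%E /\
     (Wbar P lambda Q <=
        K%:R%:E * (D_const P lambda A * (lambda_tot lambda)^-1%:E)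
        * c^-1%:E)%E) /\
  ((K %| N)%N ->
   (forall i, lambda ord0 i = lambda_tot lambda / N%:R) ->
   poisson_arrivals P lambda A ->
   [/\ beta_admissible lambda rho 0 K,
       (Qbar_tot P Q <=
          ((2 * K%:R * lambda_tot lambda - lambda_tot lambda ^+ 2)
           / (1 - rho))%:E)%E
     & (Wbar P lambda Q <=
          ((2 * K%:R - lambda_tot lambda) / (1 - rho))%:E)%E]).
Proof.
case: K_smallest => K0 K_large _.
have rate_le : lambda_tot lambda <= rho.
  case: lambda_rho => x /capacity_rate_le1 x1 <-.
  rewrite /lambda_tot; under eq_bigr => i _ do rewrite mxE.
  by rewrite -mulr_sumr ler_piMr//; exact: ltW.
split.
  exact: (lcq_backlog_delay_bound model lambda_gt0 pmin_gt0 pmin_lt1 tie_lcq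
    dynamics rho_lt1 rate_le K0 K_le_N K_large).
exact: (lcq_uniform_poisson_bound model lambda_gt0 pmin_gt0 pmin_lt1 tie_lcq
  dynamics rho_lt1 rate_le K0 K_le_N K_large).
Qed.
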